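(* Let $u$ be the solution of the time-fractional Cahn--Hilliard equation $$\partial_t^\alpha u=\gamma\Delta\big(-\varepsilon^2\Delta u+F'(u)\big),\qquad x\in\Omega,\ 0<t<T,$$ with homogeneous Dirichlet boundary condition, where $\alpha\in(0,1)$, $\gamma>0$, $\varepsilon>0$ and $F(u)=\frac14(u^2-1)^2$. Let $\Psi(t,x)$ be the solution of $$-\Delta\Psi(t,x)=u(t,x)-u(0,x),\qquad x\in\Omega,\ t\ge0,$$ with homogeneous Dirichlet boundary condition, zero mean $\int_\Omega\Psi(t,x)\,dx=0$, and zero initial condition $\Psi(0,x)=0$. For $\beta\in\{\alpha,\alpha+1\}$ set $$D_{\Delta,\beta}(t)=\frac{\|\nabla\Psi(t,\cdot)\|^2}{2t^{\beta}}+\frac{\beta}{2}\int_0^t\frac{\|\nabla(\Psi(t,\cdot)-\Psi(\tau,\cdot))\|^2}{(t-\tau)^{\beta+1}}\,d\tau,$$ and define the modified energy $$\widetilde E(t)=E(t)+\frac{1}{\gamma\Gamma(1-\alpha)}D_{\Delta,\alpha}(t),\qquad E(t)=\int_\Omega\Big(\frac{\varepsilon^2}{2}|\nabla u(t,x)|^2+F(u(t,x))\Big)dx.$$ Assume that $D_{\Delta,\alpha}(t)$ and $D_{\Delta,\alpha+1}(t)$ are well defined for $0<t\le T$. Then the following decreasing energy dissipation law holds: $$E(t)\le\widetilde E(t)\le\widetilde E(s)\le E(0)\qquad\text{for all }0\le s\le t\le T.$$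
   Context: $\Omega$ is the spatial domain, $T>0$ is the final time, and $\|\cdot\|$ is the standard spatial $L^2(\Omega)$ norm. The constant $\varepsilon$ is the interface width and $\gamma$ is the diffusion mobility constant. $\Gamma$ is the Gamma function. The operator $\partial_t^\alpha$ is the Caputo fractional derivative $\partial_t^\alpha u(t)=\frac{1}{\Gamma(1-\alpha)}\int_0^t\frac{\partial_\tau u(\tau)}{(t-\tau)^\alpha}\,d\tau$ for $t>0$. $E$ is the original Ginzburg--Landau energy, and $\widetilde E$ is an upper bound of it. *)

(* Defs.v *)
From HB Require Import structures.
From mathcomp Require Import all_boot all_order all_algebra.
From mathcomp Require Import all_classical all_reals all_analysis.
Set Implicit Arguments.
Unset Strict Implicit.
Unset Printing Implicit Defensive.
Import Order.TTheory GRing.Theory Num.Theory.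
Import numFieldNormedType.Exports.
Local Open Scope classical_set_scope.
Local Open Scope ring_scope.

(* The sigma-algebra on R^n generated by the coordinate maps, as for
   n.-tuple; since R is second countable it is the Borel sigma-algebra. *)
Section measurable_rV.
Context (R : realType) (n : nat).
Let coors : 'I_n -> 'rV[R]_n -> measurableTypeR R := fun i x => x ord0 i.

Let rV_set0 : g_sigma_preimage coors set0.
Proof. exact: sigma_algebra0. Qed.

Let rV_setC A : g_sigma_preimage coors A -> g_sigma_preimage coors (~` A).
Proof. exact: sigma_algebraC. Qed.

Let rV_bigcup (F : (set 'rV[R]_n)^nat) :
  (forall i, g_sigma_preimage coors (F i)) ->
  g_sigma_preimage coors (\bigcup_i (F i)).
Proof. exact: sigma_algebra_bigcup. Qed.

HB.instance Definition _ := @isMeasurable.Build default_measure_display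
  'rV[R]_n (g_sigma_preimage coors) rV_set0 rV_setC rV_bigcup.

Lemma measurable_coord (i : 'I_n) :
  measurable_fun [set: 'rV[R]_n] (fun x => x ord0 i : measurableTypeR R).
Proof.
move=> _ Y mY; rewrite setTI; apply: sub_sigma_algebra => /=.
rewrite -bigcup_seq/=; exists i => /=; first by rewrite mem_index_enum.
by exists Y => //; rewrite setTI.
Qed.

Lemma measurable_fun_rVP d (T : measurableType d) (f : T -> 'rV[R]_n) :
  (forall i, measurable_fun [set: T] (fun x => f x ord0 i : measurableTypeR R))
  -> measurable_fun [set: T] f.
Proof.
move=> mf _ A mA; rewrite setTI.
have : g_sigma_preimage coors `<=` image_set_system setT f measurable.
  apply: smallest_sub; first by apply: sigma_algebra_image; exact: sigma_algebra_measurable.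
  move=> B; rewrite -bigcup_seq => -[i _ [C mC <-]].
  by rewrite /image_set_system/= !setTI -[X in measurable X]setTI; exact: mf.
by move=> /(_ A mA); rewrite /image_set_system/= setTI.
Qed.
End measurable_rV.

Section lebesgue_rV.
Context (R : realType).

Definition consrV n (p : measurableTypeR R * 'rV[R]_n) : 'rV[R]_n.+1 :=
  \row_j if unlift ord0 j is Some k then p.2 ord0 k else p.1.

Definition unconsrV n (x : 'rV[R]_n.+1) : measurableTypeR R * 'rV[R]_n :=
  (x ord0 ord0, \row_k x ord0 (lift ord0 k)).

Lemma consrVK n : cancel (@consrV n) (@unconsrV n).
Proof.
move=> [a y]; rewrite /unconsrV !mxE unlift_none /=; congr pair.
by apply/rowP => k; rewrite !mxE liftK.
Qed.

Lemma measurable_consrV n : measurable_fun setT (@consrV n).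
Proof.
apply: measurable_fun_rVP => i.
rewrite (_ : (fun _ => _) = fun p : measurableTypeR R * 'rV[R]_n =>
    if unlift ord0 i is Some k then p.2 ord0 k else p.1); last first.
  by apply/funext => p; rewrite mxE.
case: unlift => [k|]; last exact: measurable_fst.
exact: (measurableT_comp (measurable_coord k) measurable_snd).
Qed.

Lemma measurable_unconsrV n : measurable_fun setT (@unconsrV n).
Proof.
apply/measurable_fun_pair; first exact: measurable_coord.
apply: measurable_fun_rVP => i.
rewrite (_ : (fun _ => _) = fun x : 'rV[R]_n.+1 => x ord0 (lift ord0 i)).
  exact: measurable_coord.
by apply/funext => x; rewrite mxE.
Qed.

Section step.
Context (n : nat) (m : {sigma_finite_measure set 'rV[R]_n -> \bar R}).

Definition step_measure : set 'rV[R]_n.+1 -> \bar R :=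
  pushforward (lebesgue_measure \x m)%E (@consrV n).

Let step0 : step_measure set0 = 0%E.
Proof. by rewrite /step_measure /pushforward preimage_set0 measure0. Qed.

Let step_ge0 A : (0 <= step_measure A)%E.
Proof. by rewrite /step_measure /pushforward measure_ge0. Qed.

Let step_sigma_additive : semi_sigma_additive step_measure.
Proof.
move=> F mF tF mUF; rewrite /step_measure /pushforward preimage_bigcup.
apply: measure_semi_sigma_additive.
- by move=> k; rewrite -[X in measurable X]setTI; exact: measurable_consrV.
- apply/trivIsetP => /= i j _ _ ij; rewrite -preimage_setI.
  by move/trivIsetP : tF => /(_ _ _ _ _ ij) ->//; rewrite preimage_set0.
- rewrite -preimage_bigcup -[X in measurable X]setTI.
  exact: measurable_consrV.
Qed.

HB.instance Definition _ := isMeasure.Build _ _ _ step_measure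
  step0 step_ge0 step_sigma_additive.

Let step_sigma_finite : sigma_finite setT step_measure.
Proof.
have /sigma_finiteP[F [FT ndF Foo]] := sigma_finiteT (@lebesgue_measure R).
have /sigma_finiteP[G [GT ndG Goo]] := sigma_finiteT m.
exists (fun k => @unconsrV n @^-1` (F k `*` G k)).
  apply/esym; rewrite -subTset => x _.
  have [i _ Fi] : (\bigcup_k F k) (x ord0 ord0) by rewrite -FT.
  have [j _ Gj] : (\bigcup_k G k) (unconsrV x).2 by rewrite -GT.
  exists (maxn i j) => //; split => /=.
  - by move: Fi; exact/subsetPset/ndF/leq_maxl.
  - by move: Gj; exact/subsetPset/ndG/leq_maxr.
move=> k; have [mF Fk] := Foo k; have [mG Gk] := Goo k; split.
  rewrite -[X in measurable X]setTI; apply: measurable_unconsrV => //.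
  exact: measurableX.
rewrite /step_measure /pushforward -comp_preimage.
rewrite (_ : _ \o _ = id); last by apply/funext => p /=; rewrite consrVK.
by rewrite preimage_id product_measure1E// lte_mul_pinfty// ge0_fin_numE.
Qed.

HB.instance Definition _ := Measure_isSigmaFinite.Build _ _ _ step_measure
  step_sigma_finite.
End step.

(* n-dimensional Lebesgue measure, as the iterated product of the
   one-dimensional one. *)
Fixpoint lebesgue_rV n : {sigma_finite_measure set 'rV[R]_n -> \bar R} :=
  match n with
  | 0 => \d_(0 : 'rV[R]_0)
  | k.+1 => step_measure (lebesgue_rV k)
  end.

End lebesgue_rV.

Section sobolev.
Context (R : realType) (n : nat).
Local Notation X := 'rV[R]_n.+1.
Implicit Types (Om : set X) (f v w : X -> R) (G : X -> X).

Local Notation dx := (@lebesgue_rV R n.+1).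

Definition partial (i : 'I_n.+1) f : X -> R :=
  fun x => 'D_(delta_mx ord0 i) f x.

Definition laplacian f : X -> R := fun x => \sum_i partial i (partial i f) x.

Fixpoint class_C (k : nat) f : Prop :=
  match k with
  | 0 => continuous f
  | k'.+1 => continuous f /\ forall i,
      (forall x, derivable f x (delta_mx ord0 i)) /\ class_C k' (partial i f)
  end.

(* C_c^oo(Om) *)
Definition test_function Om f : Prop :=
  (forall k, class_C k f) /\
  exists2 K : set X, compact K /\ K `<=` Om & forall x, ~ K x -> f x = 0.

Definition in_Lp (p : nat) Om f : Prop :=
  measurable_fun Om f /\ dx.-integrable Om (fun x => (`|f x| ^+ p)%:E).

Definition normL2 Om f : R := Num.sqrt (\int[dx]_(x in Om) f x ^+ 2).

(* || G ||^2 in L^2(Om; R^d), for a vector field G *)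
Definition sqnormL2 Om G : R := \int[dx]_(x in Om) \sum_i G x ord0 i ^+ 2.

(* v in L^2(Om) has distributional gradient G in L^2(Om; R^d) *)
Definition weak_gradient Om v G : Prop :=
  [/\ in_Lp 2 Om v, forall i, in_Lp 2 Om (fun x => G x ord0 i) &
      forall f i, test_function Om f ->
        \int[dx]_(x in Om) (v x * partial i f x) =
        - \int[dx]_(x in Om) (G x ord0 i * f x)].

(* v in L^2(Om) has distributional Laplacian w in L^2(Om) *)
Definition weak_laplacian Om v w : Prop :=
  [/\ in_Lp 2 Om v, in_Lp 2 Om w &
      forall f, test_function Om f ->
        \int[dx]_(x in Om) (v x * laplacian f x) =
        \int[dx]_(x in Om) (w x * f x)].

(* v belongs to H^1_0(Om), the closure of C_c^oo(Om) in H^1(Om), and G is its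
   gradient. This is the homogeneous Dirichlet condition; it needs no
   regularity of the boundary of Om. *)
Definition in_H10 Om v G : Prop :=
  weak_gradient Om v G /\
  exists2 f : (X -> R)^nat, forall k, test_function Om (f k) &
    normL2 Om (fun x => f k x - v x) @[k --> \oo] --> 0 /\
    forall i,
      normL2 Om (fun x => partial i (f k) x - G x ord0 i) @[k --> \oo] --> 0.

(* w in C(A; L^p(Om)), for a set of times A *)
Definition continuous_Lp (p : nat) Om (A : set R) (w : R -> X -> R) : Prop :=
  forall s, A s ->
    \int[dx]_(x in Om) `|w t x - w s x| ^+ p @[t --> within A (nbhs s)] --> 0.

Definition partial_t (u : R -> X -> R) (t : R) (x : X) : R :=
  derive1 (fun r => u r x) t.

(* u is in C^1(]0, T[; L^2(Om)) and in W^{1,1}(0, T; L^2(Om)), the derivative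
   being the pointwise one. No boundedness of the derivative near t = 0 is
   required: solutions typically behave like t^alpha there. *)
Definition time_regular Om (T : R) (u : R -> X -> R) : Prop :=
  [/\ forall x, Om x -> forall t, 0 < t < T -> derivable (fun r => u r x) t 1,
      forall t, 0 < t < T -> in_Lp 2 Om (partial_t u t) /\
        normL2 Om (fun x => h^-1 * (u (t + h) x - u t x) - partial_t u t x)
          @[h --> 0^'] --> 0,
      continuous_Lp 2 Om `]0, T[ (partial_t u) &
      lebesgue_measure.-integrable `]0, T[
        (fun t => (normL2 Om (partial_t u t))%:E)].

End sobolev.

Section time_fractional_cahn_hilliard.
Context (R : realType).

Definition Gamma (z : R) : R :=
  \int[lebesgue_measure]_(x in `]0, +oo[) (x `^ (z - 1) * expR (- x)).

Definition caputo (alpha : R) (v : R -> R) (t : R) : R :=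
  (Gamma (1 - alpha))^-1 *
  \int[lebesgue_measure]_(tau in `]0, t[) (derive1 v tau / (t - tau) `^ alpha).

Definition double_well (s : R) : R := 4^-1 * (s ^+ 2 - 1) ^+ 2.

Context (n : nat).
Local Notation X := 'rV[R]_n.+1.
Local Notation dx := (@lebesgue_rV R n.+1).
Implicit Types (Om : set X) (u Psi : R -> X -> R) (Gu GPsi : R -> X -> X).

Definition chemical_potential (eps : R) (v Lv : X -> R) (x : X) : R :=
  - eps ^+ 2 * Lv x + derive1 double_well (v x).

(* u solves the equation on ]0, T[ x Om, and Gu is its spatial gradient.
   Being of order four in space, the equation takes two boundary conditions:
   both u and the chemical potential m = - eps^2 Lap u + F'(u) vanish on the
   boundary (equivalently u = Lap u = 0 there, as F'(0) = 0). *)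
Record tfCH_solution Om (T alpha gamma eps : R) u Gu : Prop := {
  tfCH_dirichlet : forall t, 0 <= t <= T -> in_H10 Om (u t) (Gu t);
  tfCH_L4 : forall t, 0 <= t <= T -> in_Lp 4 Om (u t);
  tfCH_continuous :
    [/\ continuous_Lp 2 Om `[0, T] u, continuous_Lp 4 Om `[0, T] u &
        forall i, continuous_Lp 2 Om `[0, T] (fun t x => Gu t x ord0 i)];
  tfCH_time_regular : time_regular Om T u;
  tfCH_equation : forall t, 0 < t < T ->
    exists (Lu : X -> R) (Gm : X -> X) (Lm : X -> R),
      let m := chemical_potential eps (u t) Lu in
      [/\ weak_laplacian Om (u t) Lu,
          in_H10 Om m Gm,
          weak_laplacian Om m Lm &
          {ae dx, forall x, Om x ->
             caputo alpha (fun r => u r x) t = gamma * Lm x}]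
}.

(* - Lap Psi(t) = u(t) - u(0), and GPsi is the spatial gradient of Psi. *)
Record inverse_laplacian Om (T : R) u Psi GPsi : Prop := {
  ilap_dirichlet : forall t, 0 <= t <= T -> in_H10 Om (Psi t) (GPsi t);
  ilap_equation : forall t, 0 <= t <= T ->
    exists2 LPsi : X -> R, weak_laplacian Om (Psi t) LPsi &
      {ae dx, forall x, Om x -> - LPsi x = u t x - u 0 x};
  ilap_mean0 : forall t, 0 <= t <= T -> \int[dx]_(x in Om) Psi t x = 0;
  ilap_init : forall x, Om x -> Psi 0 x = 0
}.

Definition memory_integrand Om (beta : R) GPsi (t tau : R) : R :=
  sqnormL2 Om (fun x => GPsi t x - GPsi tau x) / (t - tau) `^ (beta + 1).

(* D_{Delta, beta}(t); for Psi(0) = 0 its value at t = 0 is 0, since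
   0 / 0 = 0 and the integral is over a null set. *)
Definition memory_term Om (beta : R) GPsi (t : R) : R :=
  sqnormL2 Om (GPsi t) / (2 * t `^ beta) +
  beta / 2 *
    \int[lebesgue_measure]_(tau in `[0, t]) memory_integrand Om beta GPsi t tau.

Definition memory_well_defined Om (beta : R) GPsi (t : R) : Prop :=
  lebesgue_measure.-integrable `[0, t]
    (fun tau => (memory_integrand Om beta GPsi t tau)%:E).

Definition energy Om (eps : R) u Gu (t : R) : R :=
  \int[dx]_(x in Om)
    (eps ^+ 2 / 2 * (\sum_i Gu t x ord0 i ^+ 2) + double_well (u t x)).

Definition modified_energy Om (alpha gamma eps : R) u Gu GPsi (t : R) : R :=
  energy Om eps u Gu t +
  (gamma * Gamma (1 - alpha))^-1 * memory_term Om alpha GPsi t.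

End time_fractional_cahn_hilliard.

(* Main.v *)
Require Import Defs.
From mathcomp Require Import all_boot all_order all_algebra.
From mathcomp Require Import all_classical all_reals all_analysis measurable_realfun.
From mathcomp Require Import ring lra.
Set Implicit Arguments.
Unset Strict Implicit.
Unset Printing Implicit Defensive.
Import Order.TTheory GRing.Theory Num.Theory.
Import numFieldNormedType.Exports.
Local Open Scope classical_set_scope.
Local Open Scope ring_scope.

(** Write N(t,s) for |grad (Psi(t) - Psi(s))|^2, D for the memory term D_alpha,
    kappa for 1 / (gamma Gamma(1 - alpha)), and (., .) for the L^2 pairing.
    The energy E need not be differentiable in time, so the usual computation
    of dE/dt is replaced by a one-step estimate on E(t) - E(s), for 0 < t < T
    and 0 <= s <= T.

    Since |grad u|^2 is convex and F'' >= -1,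
      E(t) - E(s) <= (m(t), u(t) - u(s)) + |u(t) - u(s)|^2 / 2,
    m being the chemical potential ([energy_increment_le]). As u(t) - u(s) is
    the negative Laplacian of Psi(t) - Psi(s), Green's formula ([green]) and the
    equation turn the pairing into
      - (1/gamma) (caputo u (t), Psi(t) - Psi(s)).
    Exchanging the time integral with the pairing and integrating by parts in
    time ([ip_caputo_by_parts]) trades the time derivative of u for differences
    u(t) - u(tau); pairing these with Psi(t) - Psi(s) gives the products
      P(t,tau,s) = (grad (Psi(t) - Psi(tau)), grad (Psi(t) - Psi(s)))
                 = (N(t,tau) + N(t,s) - N(tau,s)) / 2.
    The outcome is [energy_inequality]: E(t) - E(s) <= |u(t) - u(s)|^2 / 2
    - kappa Q(t,s), with
      Q(t,s) = P(t,0,s) / t^alpha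
               + alpha int_0^t P(t,tau,s) / (t - tau)^(alpha + 1) dtau.

    Interior times, 0 < s < t < T. The kernel (t - tau)^(-alpha-1) decreases
    with t, which yields D(t) - D(s) <= Q(t,s) + C (t - s)^(2 - alpha)
    ([fractional_memory_increment]). The error comes from tau in [s, t]: on
    compact subintervals of ]0, T[ the function u is Lipschitz in L^2, and the
    Poincare inequality passes this on to grad Psi. Adding the two estimates,
    the modified energy grows by at most C' (t - s)^(2 - alpha) from s to t;
    as 2 - alpha > 1, summing over finer and finer subdivisions shows that it
    does not grow at all ([le_of_superlinear_increments]).

    Final time. The equation says nothing at T, so the bound is passed to the
    limit t -> T: E is lower semicontinuous at T by the same convexity
    estimate, and D by Fatou's lemma.

    Initial time. The Lipschitz bound degenerates at 0, where u may behave like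
    t^alpha. Let r > 0 be small and let v in ]0, r] maximise N(., 0) on [0, r].
    Then P(v,tau,0) >= N(v,tau) / 2 for tau <= v, so that Q(v,0) >= D(v), and
    the one-step estimate with s = 0 bounds the modified energy at v by
    E(0) + |u(v) - u(0)|^2 / 2. The last term vanishes as r -> 0.

    The Dirichlet conditions are used only in the form of approximation by test
    functions, and derivatives in space are always distributional, so that no
    trace or regularity of the boundary enters. *)

(** * Integrability of real-valued functions *)

Section real_integrable.
Context d (T : measurableType d) (R : realType) (m : {measure set T -> \bar R}).
Variable D : set T.
Hypothesis mD : measurable D.
Implicit Types f g : T -> R.

Lemma integrableD_EFin f g : m.-integrable D (EFin \o f) ->
  m.-integrable D (EFin \o g) ->
  m.-integrable D (EFin \o (fun x => f x + g x)).
Proof.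
move=> hf hg; have := integrableD mD hf hg.
by apply: eq_integrable => // x _ /=; rewrite EFinD.
Qed.

Lemma integrableB_EFin f g : m.-integrable D (EFin \o f) ->
  m.-integrable D (EFin \o g) ->
  m.-integrable D (EFin \o (fun x => f x - g x)).
Proof.
move=> hf hg; have := integrableB mD hf hg.
by apply: eq_integrable => // x _ /=; rewrite EFinB.
Qed.

Lemma integrableZ_EFin (c : R) f : m.-integrable D (EFin \o f) ->
  m.-integrable D (EFin \o (fun x => c * f x)).
Proof.
move=> hf; have := integrableZl mD c hf.
by apply: eq_integrable => // x _ /=; rewrite EFinM.
Qed.

Lemma integrable_le_EFin f g : measurable_fun D f ->
  (forall x, D x -> `|f x| <= g x) ->
  m.-integrable D (EFin \o g) -> m.-integrable D (EFin \o f).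
Proof.
move=> mf fg; apply: le_integrable => //; first exact/measurable_EFinP.
move=> x xab /=; rewrite lee_fin; apply: (le_trans (fg _ xab)); exact: ler_norm.
Qed.

End real_integrable.

(** * Integration by parts against the fractional kernel *)
Section one_dimensional.
Context {R : realType}.
Notation mu := (@lebesgue_measure R).
Implicit Types (f h H : R -> R) (a b s t : R).

(** The derivative h may blow up at both ends: mere integrability replaces the
    one-sided limits that the classical fundamental theorem asks of it. The
    indefinite integral of h is continuous on the closed interval and has the
    same derivative as H inside, so the mean value theorem makes their
    difference constant. *)
Lemma Rintegral_derivative H h a b : a < b ->
  mu.-integrable `[a, b] (EFin \o h) ->
  {in `]a, b[, continuous h} ->
  {within `[a, b], continuous H} ->
  (forall x, x \in `]a, b[ -> is_derive x 1 H (h x)) ->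
  \int[mu]_(x in `[a, b]) h x = H b - H a.
Proof.
move=> ab ih ch cH dH.
pose G x := \int[mu]_(t in `[a, x]) h t.
have cG : {within `[a, b], continuous G}.
  exact: (parameterized_integral_continuous (ltW ab) ih).
have dG x : x \in `]a, b[ -> is_derive x 1 G (h x).
  move=> xab; move: (xab); rewrite in_itv/= => /andP[ax xb].
  have [dG G'] := continuous_FTC1_closed xb ih ax (ch x xab).
  split; first exact: dG.
  by rewrite -derive1E; exact: G'.
have [||c _] := @MVT _ (H \- G) (fun=> 0) a b ab.
- move=> x xab; have Hx := dH x xab; have Gx := dG x xab.
  by rewrite -[0](subrr (h x)); exact: is_deriveB.
- by move=> x; apply: cvgB; [exact: cH|exact: cG].
rewrite mul0r /= => /eqP; rewrite subr_eq0 => /eqP.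
have -> : G a = 0 by rewrite /G set_itv1 Rintegral_set1.
by rewrite subr0 => <-; rewrite opprB addrC subrK.
Qed.

Lemma is_derive_kernel (p t x : R) : x < t ->
  is_derive x 1 (fun tau => (t - tau) `^ p) (- (p * (t - x) `^ (p - 1))).
Proof.
move=> xt.
have h : is_derive x 1 (fun tau : R => t - tau) (-1).
  by have := is_deriveB (is_derive_cst t x (1:R)) (is_derive_id x (1:R)); rewrite sub0r.
have k : is_derive (t - x) 1 (fun y : R => y `^ p) (p * (t - x) `^ (p - 1)).
  by apply: is_derive1_powR; rewrite subr_gt0.
have := @is_derive1_comp _ (fun y : R => y `^ p) (fun tau => t - tau) x _ _ k h.
by rewrite mulrN1.
Qed.

Lemma continuous_kernel (p t x : R) : x < t ->
  {for x, continuous (fun tau => (t - tau) `^ p)}.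
Proof.
move=> xt; apply: differentiable_continuous; apply/derivable1_diffP.
by have [] := is_derive_kernel p xt.
Qed.

Lemma cvg_kernel_left (p t : R) : 0 < p ->
  (t - tau) `^ p @[tau --> t^'-] --> 0.
Proof.
move=> p0; have h : (t - tau) @[tau --> t^'-] --> 0^'+.
  move=> A [e /= e0 H]; exists e => //= x xe xt; apply: H => /=.
    by rewrite sub0r normrN.
  by rewrite subr_gt0.
exact: (cvg_comp _ _ h (powR_cvg0 p0)).
Qed.

(** The kernel is singular at t, so it is integrated on [s, t - (t - s)/(k + 2)]
    and k is sent to infinity by monotone convergence. *)
Lemma integral_kernel (p s t : R) : 0 < p < 1 -> s < t ->
  (\int[mu]_(tau in `[s, t[) ((t - tau) `^ (- p))%:E <=
   ((1 - p)^-1 * (t - s) `^ (1 - p))%:E)%E.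
Proof.
move=> /andP[p0 p1] st.
pose F k := `[s, t - (t - s) / k.+2%:R]%classic : set R.
have tsk k : 0 < (t - s) / k.+2%:R by rewrite divr_gt0// subr_gt0.
have Fbig : \bigcup_k F k = `[s, t[%classic.
  apply/seteqP; split=> x.
    by move=> [k _]; rewrite /F /= !in_itv/= => /andP[-> xk]/=; rewrite (le_lt_trans xk)// ltrBlDr ltrDl.
  rewrite /= in_itv/= => /andP[sx xt].
  have [k kP] : exists k : nat, (t - s) / (t - x) < k%:R.
    exists (Num.truncn ((t - s) / (t - x))).+1; exact: truncnS_gt.
  exists k => //; rewrite /F /= in_itv/= sx/= lerBrDr -lerBrDl.
  rewrite ler_pdivrMr// mulrC -ler_pdivrMr ?subr_gt0//.
  by rewrite (le_trans (ltW kP))// ler_nat -addn2 leq_addr.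
rewrite -Fbig.
have mF k : measurable (F k) by exact: measurable_itv.
have mk : measurable_fun `[s, t[ (EFin \o (fun tau : R => (t - tau) `^ (- p))).
  apply/measurable_EFinP; apply: (measurableT_comp (measurable_powR _)).
  by apply: measurable_funB => //; exact: measurable_id.
have ndF : nondecreasing_seq F.
  move=> i j ij; apply/subsetPset => x; rewrite /F /= !in_itv/= => /andP[-> xi]/=.
  rewrite (le_trans xi)// lerB// ler_pM2l ?subr_gt0// lef_pV2 ?posrE//.
  by rewrite ler_nat !ltnS.
have cv : (\int[mu]_(x in F i) ((t - x) `^ (- p))%:E @[i --> \oo] -->
    \int[mu]_(x in \bigcup_i F i) ((t - x) `^ (- p))%:E)%E.
  apply: ge0_nondecreasing_set_cvg_integral => //.
  - move=> i; apply: measurable_funS mk => //; rewrite -Fbig.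
    exact: bigcup_sup.
  - by move=> i x _; rewrite lee_fin powR_ge0.
rewrite -(cvg_lim _ cv)//; apply: lime_le; first by apply/cvg_ex; eexists; exact: cv.
apply: nearW => k.
have q0 : 0 < 1 - p by rewrite subr_gt0.
have sk : s < t - (t - s) / k.+2%:R.
  rewrite ltrBrDr -ltrBrDl ltr_pdivrMr// mulrC ltr_pMl ?subr_gt0//.
  by rewrite ltr1n.
have xt (x : R) : x <= t - (t - s) / k.+2%:R -> x < t.
  by move=> h; rewrite (le_lt_trans h)// ltrBlDr ltrDl.
have dH (x : R) : x < t -> is_derive x 1 (fun tau => - ((1 - p)^-1 * (t - tau) `^ (1 - p)))
    ((t - x) `^ (- p)).
  move=> h; have := is_deriveN (is_deriveZ (1 - p)^-1 (is_derive_kernel (1 - p) h)).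
  have <- : - ((1 - p)^-1 *: - ((1 - p) * (t - x) `^ (1 - p - 1))) =
      (t - x) `^ (- p) :> R; last by [].
  rewrite scalerN opprK /GRing.scale/= mulrA mulVf ?gt_eqF// mul1r.
  by congr (_ `^ _); lra.
have -> := @continuous_FTC2 _ (fun tau => (t - tau) `^ (- p))
   (fun tau => - ((1 - p)^-1 * (t - tau) `^ (1 - p))) _ _ sk.
- rewrite -EFinB lee_fin opprK addrC lerBlDr lerDl mulr_ge0 ?powR_ge0//.
  by rewrite invr_ge0 ltW.
- apply: continuous_in_subspaceT => x; rewrite inE/= in_itv/= => /andP[_ /xt].
  exact: continuous_kernel.
- have cH (x : R) : x < t -> {for x, continuous (fun tau => - ((1 - p)^-1 * (t - tau) `^ (1 - p)))}.
    by move=> /dH[h _]; apply: differentiable_continuous; exact/derivable1_diffP.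
  split.
  + by move=> x; rewrite in_itv/= => /andP[_ /ltW/xt/dH[]].
  + by apply: cvg_at_right_filter; apply: cH; exact: st.
  + by apply: cvg_at_left_filter; apply: cH; apply: xt.
- by move=> x; rewrite in_itv/= => /andP[_ /ltW/xt/dH[_ <-]]; rewrite derive1E.
Qed.

Lemma integrable_itv_cc (f : R -> \bar R) a b :
  mu.-integrable `]a, b[ f -> mu.-integrable `[a, b] f.
Proof.
move=> /integrableP[mf foo]; have mf' := emeasurable_fun_itv_cc mf.
apply/integrableP; split => //.
have mn : measurable_fun `]a, b] (fun x => `|f x|)%E.
  apply: measurableT_comp => //; apply: measurable_funS mf' => //.
  exact: subset_itv_oc_cc.
rewrite -integral_itv_obnd_cbnd// -integral_itv_bndo_bndc//.
exact: measurableT_comp.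
Qed.

Lemma Rintegral_itv_cc f a b : mu.-integrable `]a, b[ (EFin \o f) ->
  \int[mu]_(x in `]a, b[) f x = \int[mu]_(x in `[a, b]) f x.
Proof.
move=> /[dup] iof /integrable_itv_cc icf.
rewrite Rintegral_itv_bndo_bndc// Rintegral_itv_obnd_cbnd//.
by apply: integrableS icf => //; apply: subset_itv_oc_cc.
Qed.

Lemma integrable_kernel (p s t : R) : 0 < p < 1 -> s < t ->
  mu.-integrable `[s, t] (fun tau => ((t - tau) `^ (- p))%:E).
Proof.
move=> p01 st; apply: integrable_itv_cc.
apply: (@integrableS _ _ _ mu `[s, t[) => //.
  exact: subset_itv_oo_co.
apply/integrableP; split.
  apply/measurable_EFinP; apply: (measurableT_comp (measurable_powR _)).
  by apply: measurable_funB => //; exact: measurable_id.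
under eq_integral do rewrite gee0_abs ?lee_fin ?powR_ge0//.
by rewrite (le_lt_trans (integral_kernel p01 st))// ltry.
Qed.

Lemma Rintegral_kernel (p s t : R) : 0 < p < 1 -> s < t ->
  \int[mu]_(tau in `[s, t]) ((t - tau) `^ (- p)) <=
  (1 - p)^-1 * (t - s) `^ (1 - p).
Proof.
move=> p01 st; have ik := integrable_kernel p01 st.
have ik' : mu.-integrable `[s, t[ (fun tau => ((t - tau) `^ (- p))%:E).
  by apply: integrableS ik => //; apply: subset_itv_co_cc.
rewrite -Rintegral_itv_bndo_bndc// -lee_fin /Rintegral fineK.
  exact: integral_kernel.
exact: integrable_fin_num.
Qed.

Lemma bounded_itv f a b : a <= b -> {within `[a, b], continuous f} ->
  exists2 M : R, 0 <= M & forall x, x \in `[a, b] -> `|f x| <= M.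
Proof.
move=> ab cf; have cn : {within `[a, b], continuous (fun x => `|f x|)}.
  by move=> x; apply: cvg_norm; exact: cf.
have [c cab cM] := EVT_max ab cn; exists `|f c| => //.
Qed.

Lemma integrable_cst_itv (c a b : R) : mu.-integrable `[a, b] (EFin \o (fun=> c)).
Proof.
by apply: continuous_compact_integrable; [exact: segment_compact|move=> x; exact: cvg_cst].
Qed.

(** A Lipschitz bound of f at t, where f vanishes, lowers the order of the
    singularity from al + 1 to al < 1. Away from t, a bound of f is enough. *)
Lemma integrable_fractional_kernel (f : R -> R) (al L t0 t : R) :
  0 < al < 1 -> 0 <= t0 -> t0 < t -> 0 <= L -> {within `[0, t], continuous f} ->
  (forall tau, t0 <= tau <= t -> `|f tau| <= L * (t - tau)) ->
  mu.-integrable `[0, t] (EFin \o (fun tau => f tau / (t - tau) `^ (al + 1))).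
Proof.
move=> al01 t00 t0t L0 cf fL; have /andP[al0 al1] := al01.
have t_gt0 := le_lt_trans t00 t0t.
have [M M0 fM] := bounded_itv (ltW t_gt0) cf.
apply: (@integrable_le_EFin _ _ _ mu _ _ _ (fun tau : R => L * (t - tau) `^ (- al) + M * (t - t0) `^ (- (al + 1)))) => //.
- apply: measurable_funM.
    exact: (subspace_continuous_measurable_fun _ cf).
  rewrite (_ : (fun x : R => _) = fun x : R => (t - x) `^ (- (al + 1))); last first.
    by apply/funext => x; rewrite powRN.
  apply: (measurableT_comp (measurable_powR _)).
  by apply: measurable_funB => //; exact: measurable_id.
- move=> x /= /[dup] /fM fMx; rewrite in_itv/= => /andP[x0 xt].
  rewrite normrM normfV [`|_ `^ _|]ger0_norm ?powR_ge0//.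
  have [xt0|t0x] := leP x t0.
    rewrite -[leLHS]add0r lerD ?mulr_ge0 ?powR_ge0// -powRN ler_pM ?powR_ge0//.
    rewrite !powRN lef_pV2 ?posrE ?powR_gt0 ?subr_gt0// ?(le_lt_trans xt0)//.
    rewrite ge0_ler_powR ?nnegrE ?subr_ge0 ?(ltW t0t) ?lerB//; lra.
  rewrite -[leLHS]addr0 lerD ?mulr_ge0 ?powR_ge0//.
  have [->|xnt] := eqVneq x t.
    by rewrite subrr powR0 ?invr0 ?mulr0 ?mulr_ge0 ?powR_ge0//; lra.
  have {}xt : 0 < t - x by rewrite subr_gt0 lt_neqAle xnt.
  rewrite powRD; last by rewrite (gt_eqF xt) implybT.
  rewrite powRr1 ?(ltW xt)// invfM mulrA powRN mulrAC.
  rewrite ler_pM2r ?invr_gt0 ?powR_gt0// ler_pdivrMr//.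
  by apply: fL; rewrite (ltW t0x)/= -subr_ge0 ltW.
- apply: (@integrableD_EFin _ _ _ mu) => //.
    apply: (@integrableZ_EFin _ _ _ mu) => //; apply: integrable_kernel => //.
  exact: integrable_cst_itv.
Qed.

(** This turns a Caputo integral of phi' into an integral of differences of phi.
    The primitive is H(tau) = - (phi(t) - phi(tau)) (t - tau)^(-al): its
    derivative is the difference of the two integrands, and the Lipschitz bound
    at t makes H vanish there, so that the boundary term comes from 0 only. *)
Lemma Rintegral_fractional_by_parts (phi dphi : R -> R) (al L t0 t : R) :
  0 < al < 1 -> 0 <= t0 -> t0 < t -> 0 <= L ->
  {within `[0, t], continuous phi} ->
  (forall x, x \in `]0, t[ -> is_derive x 1 phi (dphi x)) ->
  {in `]0, t[, continuous dphi} ->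
  mu.-integrable `]0, t[ (EFin \o (fun tau => dphi tau / (t - tau) `^ al)) ->
  (forall tau, t0 <= tau <= t -> `|phi t - phi tau| <= L * (t - tau)) ->
  mu.-integrable `[0, t]
    (EFin \o (fun tau => (phi t - phi tau) / (t - tau) `^ (al + 1))) /\
  \int[mu]_(tau in `]0, t[) (dphi tau / (t - tau) `^ al) =
  (phi t - phi 0) / t `^ al +
  al * \int[mu]_(tau in `[0, t]) ((phi t - phi tau) / (t - tau) `^ (al + 1)).
Proof.
move=> al01 t00 t0t L0 cphi dphiP cdphi idphi phiL.
have /andP[al0 al1] := al01.
have t_gt0 := le_lt_trans t00 t0t.
have cdiff : {within `[0, t], continuous (fun tau => phi t - phi tau)}.
  by move=> x; apply: cvgB; [exact: cvg_cst|exact: cphi].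
have ig := integrable_fractional_kernel al01 t00 t0t L0 cdiff phiL.
split => //.
have icd := integrable_itv_cc idphi.
have iag := @integrableZ_EFin _ _ _ mu _ (measurable_itv `[0, t]) al _ ig.
set h := fun tau => dphi tau / (t - tau) `^ al -
   al * ((phi t - phi tau) / (t - tau) `^ (al + 1)).
pose H tau := - (phi t - phi tau) * (t - tau) `^ (- al).
have ih : mu.-integrable `[0, t] (EFin \o h).
  exact: (@integrableB_EFin _ _ _ mu _ (measurable_itv `[0, t]) _ _ icd iag).
have dH (x : R) : x \in `]0, t[ -> is_derive x 1 H (h x).
  move=> xin; move: (xin); rewrite in_itv/= => /andP[x0 xt].
  have k := is_derive_kernel (- al) xt.
  have d := dphiP x xin.
  have e := is_deriveN (is_deriveB (is_derive_cst (phi t) x (1:R)) d).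
  have := is_deriveM e k.
  have -> // : (- (phi t - phi x)) *: (- (- al * (t - x) `^ (- al - 1))) +
     (t - x) `^ (- al) *: (- (0 - dphi x)) = h x :> R.
  rewrite /h -!powRN; have -> : - (al + 1) = - al - 1 by rewrite opprD.
  rewrite /GRing.scale/=; ring.
have ch : {in `]0, t[, continuous h}.
  move=> x xin; move: (xin); rewrite in_itv/= => /andP[x0 xt].
  have cx : {for x, continuous phi}.
    by have [dx _] := dphiP x xin; apply: differentiable_continuous; exact/derivable1_diffP.
  rewrite (_ : h = (fun tau => dphi tau * (t - tau) `^ (- al) -
   al * ((phi t - phi tau) * (t - tau) `^ (- (al + 1))))); last first.
    by apply/funext => y; rewrite /h !powRN.
  apply: cvgB.
    apply: cvgM; [exact: cdphi|exact: continuous_kernel].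
  apply: cvgM; first exact: cvg_cst.
  apply: cvgM; last exact: continuous_kernel.
  apply: cvgB; [exact: cvg_cst|exact: cx].
have [_ cphi0 cphit] := (continuous_within_itvP phi t_gt0).1 cphi.
have cH : {within `[0, t], continuous H}.
  apply/(continuous_within_itvP _ t_gt0); split.
  - move=> x /dH[dx _]; apply: differentiable_continuous; exact/derivable1_diffP.
  - apply: cvgM.
      by apply: cvgN; apply: cvgB; [exact: cvg_cst|exact: cphi0].
    by apply: cvg_at_right_filter; exact: continuous_kernel.
  - rewrite {2}/H subrr oppr0 mul0r.
    have c0 : (L * (t - tau) `^ (1 - al)) @[tau --> t^'-] --> 0.
      rewrite -[X in _ --> X](mulr0 L); apply: cvgM; first exact: cvg_cst.
      by apply: cvg_kernel_left; rewrite subr_gt0.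
    apply/cvgr0Pnorm_le => e e0.
    move/cvgr0Pnorm_le : c0 => /(_ e e0) c0.
    near=> x.
    have xt : x < t by near: x; exact: nbhs_left_lt.
    have xt0 : t0 <= x by near: x; exact: nbhs_left_ge.
    apply: (@le_trans _ _ `|L * (t - x) `^ (1 - al)|); last by near: x; exact: c0.
    rewrite /H normrM normrN [X in _ * X]ger0_norm ?powR_ge0//.
    rewrite [leRHS]ger0_norm ?mulr_ge0 ?powR_ge0//.
    apply: (@le_trans _ _ (L * (t - x) * (t - x) `^ (- al))).
      by rewrite ler_wpM2r ?powR_ge0//; apply: phiL; rewrite xt0 ltW.
    have tx0 : 0 < t - x by rewrite subr_gt0.
    by rewrite -mulrA ler_wpM2l// powRD ?(gt_eqF tx0) ?implybT// powRr1// ltW.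
have := Rintegral_derivative t_gt0 ih ch cH dH.
rewrite RintegralB// RintegralZl// Rintegral_itv_cc// => /eqP.
rewrite subr_eq => /eqP ->.
by rewrite /H subr0 subrr oppr0 mul0r sub0r powRN mulNr opprK.
Unshelve. all: by end_near. Qed.

Lemma le_Rintegral_itv f g a b :
  mu.-integrable `[a, b] (EFin \o f) -> mu.-integrable `[a, b] (EFin \o g) ->
  (forall x : R, a <= x <= b -> f x <= g x) ->
  \int[mu]_(x in `[a, b]) f x <= \int[mu]_(x in `[a, b]) g x.
Proof.
move=> fi gi fg; apply: le_Rintegral => // x /=; rewrite ?in_itv/=; exact: fg.
Qed.

(** * From one-step estimates to monotonicity *)

(** With n equal steps the errors add up to n K ((b - a)/n)^p, which tends to 0
    because p > 1. *)
Lemma le_of_superlinear_increments (f : R -> R) (K p a b : R) :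
  1 < p -> 0 <= K -> a <= b ->
  (forall s t, a <= s -> s < t -> t <= b -> f t <= f s + K * (t - s) `^ p) ->
  f b <= f a.
Proof.
move=> p1 K0; rewrite le_eqVlt => /predU1P[->//|ab] fK.
have ba0 : 0 < b - a by rewrite subr_gt0.
have step n : (0 < n)%N ->
    f b <= f a + K * (b - a) * ((b - a) / n%:R) `^ (p - 1).
  move=> n0; pose h := (b - a) / n%:R.
  have n0' : 0 < n%:R :> R by rewrite ltr0n.
  have h0 : 0 < h by rewrite divr_gt0.
  have hn : h * n%:R = b - a by rewrite /h divfK ?gt_eqF.
  have ih i : (i <= n)%N -> f (a + h * i%:R) <= f a + (K * h `^ p) * i%:R.
    elim: i => [|i IH] lin; first by rewrite !mulr0 !addr0.
    apply: (le_trans (fK (a + h * i%:R) _ _ _ _)).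
    - by rewrite lerDl mulr_ge0// ltW.
    - by rewrite ltrD2l ltr_pM2l// ltr_nat.
    - by rewrite -lerBrDl -hn ler_pM2l// ler_nat.
    - rewrite (_ : a + h * i.+1%:R - (a + h * i%:R) = h); last first.
        by rewrite -natr1; ring.
      by rewrite -natr1 [in leRHS]mulrDr mulr1 addrA lerD2r IH// ltnW.
  have := ih n (leqnn n); rewrite hn addrC subrK => /le_trans; apply.
  rewrite lerD2l -/h -hn -[h `^ p]mulr_powRB1 ?(ltW h0) ?(lt_trans ltr01 p1)//.
  by rewrite le_eqVlt; apply/orP; left; apply/eqP; ring.
have cv : K * (b - a) * ((b - a) / n.+1%:R) `^ (p - 1) @[n --> \oo] --> 0.
  rewrite -[X in _ --> X](mulr0 (K * (b - a))); apply: cvgM; first exact: cvg_cst.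
  have h : (b - a) / n.+1%:R @[n --> \oo] --> 0^'+.
    have c : (b - a) / n.+1%:R @[n --> \oo] --> 0.
      rewrite -[X in _ --> X](mulr0 (b - a)); apply: cvgM; first exact: cvg_cst.
      exact: cvg_harmonic.
    move=> A [e /= e0 eA]; move/cvgr0Pnorm_lt : c => /(_ e e0).
    apply: filterS => n ne; apply: eA => /=; first by rewrite sub0r normrN.
    by rewrite divr_gt0.
  by apply: (cvg_comp _ _ h (powR_cvg0 _)); rewrite subr_gt0.
rewrite -subr_le0 -(cvg_lim _ cv)//; apply: limr_ge; first by apply/cvg_ex; exists 0.
by apply: nearW => n; rewrite lerBlDl step.
Qed.

End one_dimensional.

(** * Dissipation from an energy inequality between two times *)

(** Here X stands for the bracket Q(t,s): it occurs in the bound of the energy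
    increment and of the memory increment with opposite signs, and cancels. *)
Lemma combine_increments (R : realType) (kap e1 e2 d1 d2 X W P M nn : R) :
  0 <= kap -> d1 - d2 <= X + W * P -> e1 - e2 <= nn / 2 - kap * X -> nn <= M * P ->
  e1 + kap * d1 <= e2 + kap * d2 + (kap * W + M / 2) * P.
Proof.
move=> kap0 dI eI nI; have := ler_wpM2l kap0 dI.
by rewrite mulrBr !mulrDr; lra.
Qed.

Section fractional_gradient_flow.
Context {R : realType}.
Notation mu := (@lebesgue_measure R).

(** If N t s = |psi(t) - psi(s)|^2 for a curve psi in a Hilbert space, then
    polar N t tau s is the inner product of psi(t) - psi(tau) and
    psi(t) - psi(s). *)
Definition polar (N : R -> R -> R) (t tau s : R) : R :=
  (N t tau + N t s - N tau s) / 2.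

Definition fractional_memory (al : R) (N : R -> R -> R) (t : R) : R :=
  N t 0 / (2 * t `^ al) +
  al / 2 * \int[mu]_(tau in `[0, t]) (N t tau / (t - tau) `^ (al + 1)).

(* N t s plays |grad (Psi(t) - Psi(s))|^2, N2 t s plays |u(t) - u(s)|^2, and E_le
   is what the equation contributes. N_CS is the Cauchy-Schwarz inequality and
   N_le the estimate of the potential by its source. *)
Context (T al kap C : R) (E : R -> R) (N N2 : R -> R -> R).
Hypotheses (al01 : 0 < al < 1) (kap0 : 0 <= kap) (C0 : 0 <= C).
Hypothesis N_ge0 : forall t s : R, 0 <= N t s.
Hypothesis N_sym : forall t s : R, N t s = N s t.
Hypothesis N_diag : forall t, N t t = 0.
Hypothesis N_CS : forall t tau s : R, 0 <= t <= T -> 0 <= tau <= T -> 0 <= s <= T ->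
  polar N t tau s ^+ 2 <= N t tau * N t s.
Hypothesis N_le : forall t s : R, 0 <= t <= T -> 0 <= s <= T -> N t s <= C * N2 t s.
Hypothesis N2_lip : forall a b : R, 0 < a -> a <= b -> b < T -> exists2 L : R, 0 <= L &
  forall s t : R, a <= s -> s <= t -> t <= b -> N2 t s <= L * (t - s) ^+ 2.
Hypothesis N2_cvg : forall s : R, 0 <= s <= T ->
  N2 t s @[t --> within `[0, T] (nbhs s)] --> 0.
Hypothesis int_N : forall t : R, 0 < t <= T ->
  mu.-integrable `[0, t] (EFin \o (fun tau => N t tau / (t - tau) `^ (al + 1))).
Hypothesis int_polar : forall t s : R, 0 < t < T -> 0 <= s <= T ->
  mu.-integrable `[0, t]
    (EFin \o (fun tau => polar N t tau s / (t - tau) `^ (al + 1))).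
Hypothesis E_le : forall t s : R, 0 < t < T -> 0 <= s <= T ->
  E t - E s <= N2 t s / 2 - kap * (polar N t 0 s / t `^ al +
    al * \int[mu]_(tau in `[0, t]) (polar N t tau s / (t - tau) `^ (al + 1))).

Let D := fractional_memory al N.
Let F t := E t + kap * D t.

Lemma ler_kernel (p n x s t : R) : 0 <= p -> 0 <= n -> x < s -> s <= t ->
  n / (t - x) `^ p <= n / (s - x) `^ p.
Proof.
move=> p0 n0 xs st; have xt : x < t by exact: lt_le_trans st.
rewrite ler_wpM2l// lef_pV2 ?posrE ?powR_gt0 ?subr_gt0//.
by rewrite ge0_ler_powR ?nnegrE ?subr_ge0 ?lerB ?(ltW xs) ?(ltW xt).
Qed.

(** N(x,s) - N(t,s) is N(t,x) minus twice an inner product with psi(t) - psi(x).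
    Hence it is of second order in the time steps, with a factor t - x that
    will absorb one power of the kernel. *)
Lemma N_increment_le (a b L s t x : R) : 0 < a -> b < T -> 0 <= L ->
  (forall s t : R, a <= s -> s <= t -> t <= b -> N2 t s <= L * (t - s) ^+ 2) ->
  a <= s -> s <= x -> x <= t -> t <= b ->
  N x s - N t s <= 3 * C * L * (t - s) * (t - x).
Proof.
move=> a0 bT L0 NL as_ sx xt tb.
have xT : 0 <= x <= T by lra.
have tT' : 0 <= t <= T by lra.
have sT' : 0 <= s <= T by lra.
have CS := N_CS tT' xT sT'.
have n1 : N t x <= C * L * (t - x) ^+ 2.
  apply: (le_trans (N_le tT' xT)); rewrite -mulrA ler_wpM2l//.
  by apply: NL => //; lra.
have n2 : N t s <= C * L * (t - s) ^+ 2.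
  apply: (le_trans (N_le tT' sT')); rewrite -mulrA ler_wpM2l//.
  by apply: NL => //; lra.
have CL0 : 0 <= C * L by rewrite mulr_ge0.
have p2 : `|polar N t x s| <= C * L * (t - x) * (t - s).
  rewrite -(@ler_pXn2r _ 2)// ?nnegrE ?mulr_ge0//; [|lra..].
  rewrite real_normK ?num_real//; apply: (le_trans CS).
  apply: (le_trans (ler_pM _ _ n1 n2)) => //.
  by rewrite le_eqVlt; apply/orP; left; apply/eqP; ring.
have -> : N x s - N t s = N t x - 2 * polar N t x s by rewrite /polar; field.
have n1' : C * L * (t - x) ^+ 2 <= C * L * (t - x) * (t - s).
  by rewrite expr2 mulrA ler_wpM2l ?mulr_ge0//; lra.
have := ler_norm (- polar N t x s); rewrite normrN.
have -> : 3 * C * L * (t - s) * (t - x) = 3 * (C * L * (t - x) * (t - s)) by ring.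
by move=> ?; lra.
Qed.

(** The memory integrand at t minus twice the polar one is
    g(tau) = (N(tau,s) - N(t,s)) / (t - tau)^(al + 1). On [0, s] this is at most
    the memory integrand at s, because the kernel decreases in t. On [s, t],
    where s has no counterpart, [N_increment_le] leaves the integrable kernel
    (t - tau)^(-al) and a total of order (t - s)^(2 - al). *)
Lemma fractional_memory_increment (a b L s t : R) : 0 < a -> b < T -> 0 <= L ->
  (forall s t : R, a <= s -> s <= t -> t <= b -> N2 t s <= L * (t - s) ^+ 2) ->
  a <= s -> s < t -> t <= b ->
  D t - D s <= polar N t 0 s / t `^ al +
    al * \int[mu]_(tau in `[0, t]) (polar N t tau s / (t - tau) `^ (al + 1)) +
    al / 2 * (3 * C * L / (1 - al)) * (t - s) `^ (2 - al).
Proof.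
have alg (A B1 B2 B3 X Y Z W : R) : B1 - B2 <= B3 ->
    A * (X - 2 * Y) <= A * (Z + W) ->
    (B1 + A * X) - (B2 + A * Z) <= B3 + 2 * A * Y + A * W.
  by rewrite mulrBr mulrDr; lra.
move=> a0 bT L0 NL as_ st tb; have /andP[al0 al1] := al01.
have s0 : 0 < s by exact: lt_le_trans as_.
have t0 : 0 < t by exact: lt_trans st.
have tT : t < T by exact: le_lt_trans bT.
have t0T : 0 < t <= T by rewrite t0 ltW.
have s0T : 0 < s <= T by rewrite s0 (le_trans (ltW st))// ltW.
have it := int_N t0T.
have is_ := int_N s0T.
have ip : mu.-integrable `[0, t]
    (EFin \o (fun tau => polar N t tau s / (t - tau) `^ (al + 1))).
  by apply: int_polar; rewrite ?t0// (ltW s0)/=; lra.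
have B : N t 0 / (2 * t `^ al) - N s 0 / (2 * s `^ al) <= polar N t 0 s / t `^ al.
  have ts : (t `^ al)^-1 <= (s `^ al)^-1.
    by rewrite lef_pV2 ?posrE ?powR_gt0// ge0_ler_powR ?nnegrE; lra.
  have ti : 0 <= (t `^ al)^-1 by rewrite invr_ge0 powR_ge0.
  rewrite /polar (N_sym 0 s) !invfM.
  have := N_ge0 t s; have := N_ge0 s 0; have := N_ge0 t 0.
  move: ts ti; set p := (t `^ al)^-1; set q := (s `^ al)^-1 => ts ti n1 n2 n3.
  have h1 : 0 <= N t s * p by rewrite mulr_ge0.
  have h2 : 0 <= N s 0 * (q - p) by rewrite mulr_ge0// subr_ge0.
  by lra.
pose g tau := (N tau s - N t s) / (t - tau) `^ (al + 1).
have gE (tau : R) : g tau = N t tau / (t - tau) `^ (al + 1) -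
    2 * (polar N t tau s / (t - tau) `^ (al + 1)).
  by rewrite /g /polar; move: ((_ `^ _)^-1) => q; field.
have gD (tau : R) : g tau = (N tau s - N t s) / (t - tau) `^ (al + 1) by [].
clearbody g.
have i2p := @integrableZ_EFin _ _ _ mu _ (measurable_itv `[0, t]) 2 _ ip.
have ig : mu.-integrable `[0, t] (EFin \o g).
  have := @integrableB_EFin _ _ _ mu _ (measurable_itv `[0, t]) _ _ it i2p.
  by apply: eq_integrable => // x _ /=; rewrite gE.
have Ig : \int[mu]_(tau in `[0, t]) g tau =
    \int[mu]_(tau in `[0, t]) (N t tau / (t - tau) `^ (al + 1)) -
    2 * \int[mu]_(tau in `[0, t]) (polar N t tau s / (t - tau) `^ (al + 1)).
  under eq_Rintegral do rewrite gE.
  by rewrite RintegralB// RintegralZl.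
have s_itv : `[0, t]%classic = `[0, s]%classic `|` `]s, t]%classic :> set R.
  by rewrite -itv_bndbnd_setU// bnd_simp// ltW.
have ig1 : mu.-integrable `[0, s] (EFin \o g).
  by apply: integrableS ig => //; rewrite s_itv; exact: subsetUl.
have ig2 : mu.-integrable `[s, t] (EFin \o g).
  by apply: integrableS ig => // x /=; rewrite !in_itv/= => /andP[sx ->]; rewrite (le_trans _ sx)// ltW.
have Isplit : \int[mu]_(tau in `[0, t]) g tau =
   \int[mu]_(tau in `[0, s]) g tau + \int[mu]_(tau in `[s, t]) g tau.
  have := @Rintegral_itvB _ g (BLeft 0) (BRight t) s ig.
  rewrite !bnd_simp => /(_ (ltW s0) (ltW st)) /eqP; rewrite subr_eq => /eqP ->.
  rewrite addrC Rintegral_itv_obnd_cbnd//.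
  by apply: integrableS ig2 => //; exact: subset_itv_oc_cc.
have I1 : \int[mu]_(tau in `[0, s]) g tau <=
    \int[mu]_(tau in `[0, s]) (N s tau / (s - tau) `^ (al + 1)).
  apply: le_Rintegral_itv => // x /andP[x0 xs].
  have [->|xns] := eqVneq x s.
    rewrite gD !N_diag mul0r sub0r mulNr oppr_le0 mulr_ge0//.
    by rewrite invr_ge0 powR_ge0.
  have {}xs : x < s by rewrite lt_neqAle xns.
  apply: (le_trans _ (ler_kernel _ _ xs (ltW st))) => //; last by rewrite addr_ge0// ltW.
  by rewrite gD ler_wpM2r ?invr_ge0 ?powR_ge0// N_sym lerBlDr lerDl.
have I2 : \int[mu]_(tau in `[s, t]) g tau <=
    3 * C * L / (1 - al) * (t - s) `^ (2 - al).
  have ik := integrable_kernel al01 st.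
  have ick := @integrableZ_EFin _ _ _ mu _ (measurable_itv `[s, t])
    (3 * C * L * (t - s)) _ ik.
  apply: (@le_trans _ _ (\int[mu]_(tau in `[s, t])
     (3 * C * L * (t - s) * (t - tau) `^ (- al)))).
    apply: le_Rintegral_itv => // x /andP[sx xt].
    have [->|xnt] := eqVneq x t.
      by rewrite gD subrr mul0r !mulr_ge0 ?powR_ge0// subr_ge0 ltW.
    have {}xt : 0 < t - x by rewrite subr_gt0 lt_neqAle xnt.
    have nz := gt_eqF xt.
    rewrite gD powRD ?nz ?implybT// powRr1 ?(ltW xt)// invfM mulrA powRN mulrAC.
    rewrite ler_wpM2r ?invr_ge0 ?powR_ge0// ler_pdivrMr//.
    have xt' : x <= t by rewrite -subr_ge0 ltW.
    exact: (N_increment_le a0 bT L0 NL as_ sx xt' tb).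
  rewrite RintegralZl//.
  apply: (le_trans (ler_wpM2l _ (Rintegral_kernel al01 st))).
    by rewrite !mulr_ge0// subr_ge0 ltW.
  have -> : 2 - al = 1 + (1 - al) by rewrite addrA.
  rewrite [in leRHS]powRD; last by rewrite (gt_eqF (_ : 0 < t - s)) ?implybT// subr_gt0.
  rewrite powRr1 ?subr_ge0 ?(ltW st)//.
  by rewrite le_eqVlt; apply/orP; left; apply/eqP; ring.
rewrite /D /fractional_memory.
move: I1 I2 Isplit; rewrite Ig.
set X := \int[mu]_(tau in `[0, t]) (N t tau / _).
set Y := \int[mu]_(tau in `[0, t]) (polar N t tau s / _).
set Z := \int[mu]_(tau in `[0, s]) (N s tau / _).
set G1 := \int[mu]_(tau in `[0, s]) g tau.
set G2 := \int[mu]_(tau in `[s, t]) g tau.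
set W := 3 * C * L / (1 - al).
clearbody X Y Z G1 G2 W => I1 I2 I3.
have K : al / 2 * (X - 2 * Y) <= al / 2 * (Z + W * (t - s) `^ (2 - al)).
  apply: ler_wpM2l; first by rewrite divr_ge0 ?(ltW al0).
  by rewrite I3 lerD.
have := alg _ _ _ _ _ _ _ _ B K.
have -> : 2 * (al / 2) = al by rewrite mulrC divfK.
by rewrite mulrA.
Qed.

Lemma fractional_memory_ge0 t : 0 <= D t.
Proof.
have /andP[al0 al1] := al01.
rewrite addr_ge0 ?mulr_ge0 ?invr_ge0 ?mulr_ge0 ?powR_ge0 ?(ltW al0)//.
by apply: Rintegral_ge0 => x _; rewrite divr_ge0 ?powR_ge0.
Qed.

Lemma fractional_memory0 : D 0 = 0.
Proof.
by rewrite /D /fractional_memory N_diag mul0r add0r set_itv1 Rintegral_set1 mulr0.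
Qed.

(** The memory error is of order (t - s)^(2 - al), and N2 t s / 2 is even of order
    (t - s)^2. *)
Lemma modified_energy_le_interior (s t : R) : 0 < s -> s <= t -> t < T -> F t <= F s.
Proof.
move=> s0 st tT; have /andP[al0 al1] := al01.
have [L L0 NL] := N2_lip s0 st tT.
have W0 : 0 <= al / 2 * (3 * C * L / (1 - al)).
  by rewrite !mulr_ge0 ?invr_ge0 ?subr_ge0// ltW.
apply: (@le_of_superlinear_increments _ _
   (kap * (al / 2 * (3 * C * L / (1 - al))) + L * T `^ al / 2) (2 - al)) => //.
- by lra.
- by rewrite addr_ge0 ?(mulr_ge0 kap0 W0)// divr_ge0// mulr_ge0 ?powR_ge0.
move=> x y sx xy yt.
have yx : 0 < y - x by rewrite subr_gt0.
have y0T : 0 < y < T by lra.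
have x0T : 0 <= x <= T by lra.
have yxT : y - x <= T by lra.
have N2I : N2 y x <= L * T `^ al * (y - x) `^ (2 - al).
  apply: (le_trans (NL _ _ sx (ltW xy) yt)); rewrite -mulrA ler_wpM2l//.
  have -> : (y - x) ^+ 2 = (y - x) `^ al * (y - x) `^ (2 - al).
    rewrite -powRD ?(gt_eqF yx) ?implybT//.
    by rewrite (_ : al + (2 - al) = 2%:R) ?powR_mulrn ?(ltW yx)//; lra.
  rewrite ler_wpM2r ?powR_ge0//.
  by rewrite ge0_ler_powR ?nnegrE ?(ltW al0) ?(ltW yx)// (le_trans _ yxT)// ltW.
have I := fractional_memory_increment s0 tT L0 NL sx xy yt.
have EI := E_le y0T x0T.
exact: (combine_increments kap0 I EI N2I).
Qed.

Lemma N_increment_norm (t x y : R) : 0 <= t <= T -> 0 <= x <= T -> 0 <= y <= T ->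
  `|N t y - N x y| <= N t x + 2 * (Num.sqrt (N t x) * Num.sqrt (N x y)).
Proof.
move=> tT xT yT.
have -> : N t y - N x y = N t x - 2 * polar N x t y.
  by rewrite /polar (N_sym x t); field.
apply: (le_trans (ler_normB _ _)); rewrite ger0_norm// lerD2l normrM ger0_norm//.
rewrite ler_pM2l// -sqrtrM// -(@ler_pXn2r _ 2)// ?nnegrE ?sqrtr_ge0//.
rewrite real_normK ?num_real// sqr_sqrtr ?mulr_ge0//.
by rewrite (N_sym t x); exact: N_CS.
Qed.

Lemma near_within_itv (P : R -> Prop) (x : R) :
  (forall t, 0 <= t <= T -> P t) -> \forall t \near within `[0, T] (nbhs x), P t.
Proof.
move=> h; rewrite /prop_near1 /within/=; apply: nearW => t.
by rewrite /= in_itv/=; exact: h.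
Qed.

Lemma N_cvg0 (x : R) : 0 <= x <= T -> N t x @[t --> within `[0, T] (nbhs x)] --> 0.
Proof.
move=> xT; have h : C * N2 t x @[t --> within `[0, T] (nbhs x)] --> 0.
  rewrite -[X in _ --> X](mulr0 C); apply: cvgM; [exact: cvg_cst|exact: N2_cvg].
apply: (squeeze_cvgr _ (cvg_cst 0) h); apply: near_within_itv => t tT.
by rewrite N_ge0/= N_le.
Qed.

Lemma N_cvg (x y : R) : 0 <= x <= T -> 0 <= y <= T ->
  N t y @[t --> within `[0, T] (nbhs x)] --> N x y.
Proof.
move=> xT yT.
have h : N t x + 2 * (Num.sqrt (N t x) * Num.sqrt (N x y))
    @[t --> within `[0, T] (nbhs x)] --> 0.
  have n0 := N_cvg0 xT.
  rewrite -[X in _ --> X]addr0; apply: cvgD => //.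
  rewrite -[X in _ --> X](mulr0 2); apply: cvgM; first exact: cvg_cst.
  rewrite -[X in _ --> X](mul0r (Num.sqrt (N x y))); apply: cvgM; last exact: cvg_cst.
  rewrite -[X in _ --> X](sqrtr0 R).
  exact: (cvg_comp _ _ n0 (@sqrt_continuous R 0)).
apply/cvgrPdist_le => e e0; move/cvgr0Pnorm_le : h => /(_ e e0).
apply: filter_app; apply: near_within_itv => t tT.
apply: le_trans; rewrite distrC; apply: (le_trans (N_increment_norm tT xT yT)).
exact: ler_norm.
Qed.

(** No Lipschitz bound holds down to time 0, so the increment of the memory
    cannot be estimated as at interior times. At a maximiser u of N(., 0) on
    [0, r], the polar integrand relative to s = 0 dominates half of the memory
    integrand, which gives the same comparison without error. *)
Lemma modified_energy_le_initial (t : R) : 0 < t -> t < T -> F t <= E 0.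
Proof.
move=> t0 tT; have /andP[al0 al1] := al01.
apply/ler_addgt0Pr => /= e e0.
have e2 : e / 2 <= e by lra.
have T0 : 0 <= (0 : R) <= T by lra.
have [d /= d0 dN] : \forall r \near within `[0, T] (nbhs 0), N2 r 0 <= e.
  have /cvgr0Pnorm_le/(_ e e0) := N2_cvg T0.
  by apply: filterS => r; apply: le_trans; exact: ler_norm.
pose r := Num.min (d / 2) t.
have r0 : 0 < r by rewrite lt_min t0 andbT divr_gt0.
have rt : r <= t by rewrite ge_min lexx orbT.
have rd : r < d by rewrite gt_min; apply/orP; left; lra.
have cN : {within `[0, r], continuous (fun x => N x 0)}.
  apply: (@continuous_subspaceW _ _ `[0, r]%classic `[0, T]%classic).
    by apply: subset_itvl; rewrite bnd_simp; lra.
  apply/subspace_continuousP => x /=; rewrite in_itv/= => xT.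
  exact: N_cvg.
have [c] := EVT_max (ltW r0) cN; rewrite in_itv/= => /andP[c0 cr] cmax.
have [u [u0 ur umax]] : exists u : R, [/\ 0 < u, u <= r &
    forall x, 0 <= x <= r -> N x 0 <= N u 0].
  move: c0; rewrite le_eqVlt => /predU1P[c0|c0].
    (* if the maximum is at 0 then N(., 0) vanishes and any point will do *)
    exists r; split => // x xr; apply: (le_trans (cmax x _)); first by rewrite in_itv.
    by rewrite -c0 N_diag.
  by exists c; split => // x xr; apply: cmax; rewrite in_itv.
have uT : 0 < u < T by lra.
have uT' : 0 < u <= T by lra.
have h1 : F t <= F u by apply: modified_energy_le_interior => //; lra.
have h3 : N2 u 0 <= e.
  apply: dN => /=; last by rewrite in_itv/= (ltW u0)/=; case/andP: uT'.
  by rewrite sub0r normrN gtr0_norm//; exact: le_lt_trans rd.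
have h2 := E_le uT T0.
have iN := int_N uT'.
have ip := int_polar uT T0.
have h4 : D u <= polar N u 0 0 / u `^ al +
    al * \int[mu]_(tau in `[0, u]) (polar N u tau 0 / (u - tau) `^ (al + 1)).
  apply: lerD.
    rewrite /polar N_diag subr0 invfM mulrA ler_wpM2r ?invr_ge0 ?powR_ge0//.
    by rewrite ler_wpM2r// lerDl.
  rewrite -mulrA ler_wpM2l ?(ltW al0)// -RintegralZl//.
  apply: le_Rintegral_itv => //.
    exact: (@integrableZ_EFin _ _ _ mu _ (measurable_itv `[0, u])).
  move=> x /andP[x0 xu]; rewrite mulrA ler_wpM2r ?invr_ge0 ?powR_ge0// mulrC /polar.
  rewrite ler_wpM2r// -addrA lerDl subr_ge0 umax// x0/=.
  exact: le_trans ur.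
apply: (le_trans h1).
(* the error terms are put in the shape of [combine_increments] with P = 1 *)
have h4' : D u - 0 <= polar N u 0 0 / u `^ al +
    al * \int[mu]_(tau in `[0, u]) (polar N u tau 0 / (u - tau) `^ (al + 1)) +
    0 * 1 by rewrite subr0 mul0r addr0.
have h3' : N2 u 0 <= e * 1 by rewrite mulr1.
apply: (le_trans (combine_increments kap0 h4' h2 h3')).
by rewrite mulr1 !mulr0 addr0 add0r lerD2l.
Qed.

Lemma memory_leE (A I c : R) :
  (A + al / 2 * I <= c) = (I <= 2 / al * (c - A)).
Proof.
have /andP[al0 _] := al01.
by rewrite -lerBrDl -[2 / al]invf_div ler_pdivlMl// divr_gt0.
Qed.

(** Fatou's lemma, for the integrands of D(v_n) extended by zero beyond v_n: they
    converge pointwise on [0, T[ and are nonnegative, while no common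
    integrable bound is at hand. *)
Lemma fractional_memory_lsc (v c : R^nat) (l : R) : 0 < T ->
  (forall n, 0 < v n < T) -> v n @[n --> \oo] --> T -> c n @[n --> \oo] --> l ->
  (forall n, D (v n) <= c n) -> D T <= l.
Proof.
move=> T0 vT cv cc Dc; have /andP[al0 al1] := al01.
have v0 n : 0 < v n by case/andP: (vT n).
have vltT n : v n < T by case/andP: (vT n).
have T0T : 0 < T <= T by rewrite T0 lexx.
have zT : 0 <= (0 : R) <= T by rewrite lexx ltW.
have TT : 0 <= T <= T by rewrite lexx ltW.
pose g t tau := N t tau / (t - tau) `^ (al + 1).
pose f n := (EFin \o g (v n)) \_ `[0, v n[ : R -> \bar R.
pose B n := 2 / al * (c n - N (v n) 0 / (2 * v n `^ al)).
have vW : v n @[n --> \oo] --> within `[0, T] (nbhs T).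
  move=> A; rewrite /within/= => /cv h.
  have h' : \forall n \near \oo, v n \in `[0, T] -> A (v n) by exact: h.
  apply: (filterS _ h') => n; apply.
  by rewrite in_itv/= (ltW (v0 n)) (ltW (vltT n)).
have cN (y : R) : 0 <= y <= T -> N (v n) y @[n --> \oo] --> N T y.
  by move=> yT; exact: (cvg_comp _ _ vW (N_cvg TT yT)).
have cB : B n @[n --> \oo] --> 2 / al * (l - N T 0 / (2 * T `^ al)).
  apply: cvgM; first exact: cvg_cst.
  apply: cvgB => //; apply: cvgM; first exact: cN.
  apply: cvgV; first by rewrite mulf_neq0// gt_eqF// powR_gt0.
  apply: cvgM; first exact: cvg_cst.
  have cp : {for T, continuous (fun a : R => a `^ al)}.
    apply: differentiable_continuous; apply/derivable1_diffP.
    by have [] := is_derive1_powR al T0.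
  exact: (cvg_comp _ _ cv cp).
have mf n : measurable_fun `[0, v n] (g (v n)).
  apply/measurable_EFinP; apply: (measurable_int mu); apply: int_N.
  by rewrite v0/= ltW.
have g0 n tau : (0 <= (g (v n) tau)%:E)%E by rewrite lee_fin divr_ge0 ?powR_ge0.
have DI n : `[0, T[%classic `&` `[0, v n[%classic = `[0, v n[%classic :> set R.
  apply/setIidr; apply: subset_itvl; rewrite bnd_simp; exact: ltW.
have mf' n : measurable_fun `[0, T[ (f n).
  apply/measurable_restrict => //; rewrite DI.
  apply/measurable_EFinP; apply: measurable_funS (mf n) => //.
  exact: subset_itv_co_cc.
have f0 n x : `[0, T[%classic x -> (0 <= f n x)%E.
  by move=> _; rewrite /f patchE; case: ifPn => // _; exact: g0.
have If n : (\int[mu]_(x in `[0%R, T[) f n x <= (B n)%:E)%E.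
  rewrite -integral_mkcondr DI integral_itv_bndo_bndc; last first.
    apply/measurable_EFinP; apply: measurable_funS (mf n) => //.
    exact: subset_itv_co_cc.
  have iN : mu.-integrable `[0, v n] (EFin \o g (v n)).
    by apply: int_N; rewrite v0/= ltW.
  rewrite -[leLHS]fineK; last exact: integrable_fin_num.
  by rewrite lee_fin /B -memory_leE; exact: Dc.
have lim_f x : `[0, T[%classic x -> (limn_einf (f ^~ x) = (g T x)%:E).
  move=> /=; rewrite in_itv/= => /andP[x0 xT].
  have c1 : g (v n) x @[n --> \oo] --> g T x.
    apply: cvgM; first by apply: cN; rewrite x0 ltW.
    apply: cvgV; first by rewrite gt_eqF// powR_gt0// subr_gt0.
    have cp : {for T - x, continuous (fun a : R => a `^ (al + 1))}.
      apply: differentiable_continuous; apply/derivable1_diffP.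
      have Tx : 0 < T - x by rewrite subr_gt0.
      by have [] := is_derive1_powR (al + 1) Tx.
    have cvx : v n - x @[n --> \oo] --> T - x by apply: cvgB => //; exact: cvg_cst.
    exact: (cvg_comp _ _ cvx cp).
  have c2 : f n x @[n --> \oo] --> (g T x)%:E.
    apply: (@cvg_trans _ (((g (v n) x)%:E) @[n --> \oo])); last first.
      by apply: cvg_EFin => //; exact: nearW.
    apply: near_eq_cvg; move/cvgrPdist_lt : cv => /(_ (T - x)).
    rewrite subr_gt0 => /(_ xT); apply: filterS => n vn.
    rewrite /f patchE ifT// inE/= in_itv/= x0/=.
    have := ler_norm (T - v n); lra.
  by rewrite (cvg_limn_einf_sup c2).1.
have gT : mu.-integrable `[0, T] (EFin \o g T) by exact: int_N.
have gT' : mu.-integrable `[0, T[ (EFin \o g T).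
  by apply: integrableS gT => //; exact: subset_itv_co_cc.
have I : ((\int[mu]_(x in `[0%R, T]) g T x)%R%:E <=
    (2 / al * (l - N T 0 / (2 * T `^ al)))%:E)%E.
  rewrite -Rintegral_itv_bndo_bndc// /Rintegral fineK; last exact: integrable_fin_num.
  have -> : (\int[mu]_(x in `[0%R, T[) (g T x)%:E =
     \int[mu]_(x in `[0%R, T[) limn_einf (f ^~ x))%E.
    by apply: eq_integral => x; rewrite inE => /lim_f ->.
  have mco : measurable (`[0, T[%classic : set (measurableTypeR R)) by [].
  apply: (le_trans (@fatou _ _ _ mu _ mco f mf' f0)).
  have cB' : (B n)%:E @[n --> \oo] --> (2 / al * (l - N T 0 / (2 * T `^ al)))%:E.
    by apply: cvg_EFin => //; exact: nearW.
  rewrite limn_einf_lim -(cvg_lim _ cB')//; apply: lee_lim.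
  - exact: is_cvg_einfs.
  - by apply/cvg_ex; eexists; exact: cB'.
  - apply: nearW => n; apply: le_trans (If n).
    by apply: ereal_inf_lbound; exists n => /=.
by rewrite /D /fractional_memory memory_leE -lee_fin.
Qed.

Hypothesis T_gt0 : 0 < T.
(* lower semicontinuity at T, in the form in which convexity provides it *)
Hypothesis E_lsc : exists2 err : R -> R,
  err t @[t --> within `[0, T] (nbhs T)] --> 0 &
  forall t, 0 <= t <= T -> E T <= E t + err t.

Lemma modified_energy_le_final (s : R) : 0 < s -> s < T -> F T <= F s.
Proof.
move=> s0 sT; have [err err0 Eerr] := E_lsc.
pose v n := T - (T - s) * n.+2%:R^-1 : R.
have Ts : 0 < T - s by rewrite subr_gt0.
have sv n : s <= v n.
  rewrite /v lerBrDr -lerBrDl ler_piMr ?(ltW Ts)//.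
  by rewrite invf_le1 ?ltr0n// ler1n.
have vltT n : v n < T by rewrite /v ltrBlDr ltrDl mulr_gt0// invr_gt0 ltr0n.
have vT n : 0 < v n < T by rewrite vltT (lt_le_trans s0).
have cv : v n @[n --> \oo] --> T.
  rewrite -[X in _ --> X]subr0 -(mulr0 (T - s)); apply: cvgB; first exact: cvg_cst.
  apply: cvgM; first exact: cvg_cst.
  by have := @cvg_harmonic R; rewrite -cvg_shiftS.
have vW : v n @[n --> \oo] --> within `[0, T] (nbhs T).
  move=> A; rewrite /within/= => /cv h.
  have h' : \forall n \near \oo, v n \in `[0, T] -> A (v n) by exact: h.
  apply: (filterS _ h') => n; apply.
  by have /andP[v0 v1] := vT n; rewrite in_itv/= !ltW.
have cerr : err (v n) @[n --> \oo] --> 0 := cvg_comp _ _ vW err0.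
have step n : E T + kap * D (v n) <= F s + err (v n).
  have /andP[v0 v1] := vT n.
  have h1 := modified_energy_le_interior s0 (sv n) v1.
  have h2 : E T <= E (v n) + err (v n) by apply: Eerr; rewrite !ltW.
  rewrite (le_trans (lerD h2 (lexx _)))// addrAC lerD2r.
  exact: h1.
have [k0|kn0] := eqVneq kap 0.
  have -> : F T = E T by rewrite /F k0 mul0r addr0.
  have c1 : F s + err (v n) @[n --> \oo] --> F s.
    by rewrite -[X in _ --> X]addr0; apply: cvgD => //; exact: cvg_cst.
  rewrite -(cvg_lim _ c1)//; apply: limr_ge; first by apply/cvg_ex; eexists; exact: c1.
  by apply: nearW => n; have := step n; rewrite {1}k0 mul0r addr0.
have k0 : 0 < kap by rewrite lt_neqAle eq_sym kn0.
rewrite /F -lerBrDl -ler_pdivlMl//.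
apply: (@fractional_memory_lsc v (fun n => kap^-1 * (F s - E T + err (v n)))) => //.
  apply: cvgM; first exact: cvg_cst.
  by rewrite -[X in _ --> X]addr0; apply: cvgD => //; exact: cvg_cst.
by move=> n; rewrite ler_pdivlMl// addrAC lerBrDl.
Qed.

Theorem fractional_dissipation (s t : R) : 0 <= s -> s <= t -> t <= T ->
  [/\ E t <= F t, F t <= F s & F s <= E 0].
Proof.
have F0 : F 0 = E 0 by rewrite /F fractional_memory0 mulr0 addr0.
have E_le0 x : 0 <= x -> x <= T -> F x <= E 0.
  rewrite le_eqVlt => /predU1P[<- _|x0]; first by rewrite F0.
  rewrite le_eqVlt => /predU1P[->|xT]; last exact: modified_energy_le_initial.
  have T20 : 0 < T / 2 by rewrite divr_gt0.
  have T2T : T / 2 < T by rewrite ltr_pdivrMr// ltr_pMr// ltr1n.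
  exact: (le_trans (modified_energy_le_final T20 T2T) (modified_energy_le_initial T20 T2T)).
move=> s0 st tT; split; last by apply: E_le0 => //; exact: le_trans tT.
  by rewrite lerDl mulr_ge0// fractional_memory_ge0.
move: s0; rewrite le_eqVlt => /predU1P[s0|s0].
  by rewrite -s0 F0; apply: E_le0 => //; rewrite s0.
move: st; rewrite le_eqVlt => /predU1P[->//|st].
move: tT; rewrite le_eqVlt => /predU1P[tT|tT].
  by rewrite tT in st *; exact: modified_energy_le_final.
by apply: modified_energy_le_interior => //; exact: ltW.
Qed.

End fractional_gradient_flow.

(** * Lebesgue measure on row vectors *)
Section lebesgue_measure_rV.
Context {R : realType}.

(** An open set is the union of the boxes with rational centre and radius
    1/(k + 1) that it contains, and each box is a finite intersection of
    preimages of intervals by coordinates. *)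
Lemma open_measurable_rV n (U : set 'rV[R]_n) : open U -> measurable U.
Proof.
move=> oU.
pose box (p : 'rV[rat]_n * nat) : set 'rV[R]_n :=
  [set x | forall i, `|x ord0 i - ratr (p.1 ord0 i)| < p.2.+1%:R^-1].
have mbox p : measurable (box p).
  have -> : box p = \bigcap_(i in [set: 'I_n])
      [set x | `|x ord0 i - ratr (p.1 ord0 i)| < p.2.+1%:R^-1].
    by apply/seteqP; split => [x h i _|x h i]; [exact: h|exact: (h i)].
  apply: fin_bigcap_measurable => // i _.
  rewrite [X in measurable X](_ : _ =
     setT `&` (fun x : 'rV[R]_n => x ord0 i : measurableTypeR R) @^-1`
       (ball (ratr (p.1 ord0 i) : R) p.2.+1%:R^-1)); last first.
    by rewrite setTI; apply/seteqP; split => x /=; rewrite /ball/= distrC.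
  by apply: measurable_coord => //; exact: measurable_ball.
have -> : U = \bigcup_(p in [set: 'rV[rat]_n * nat]) (if `[< box p `<=` U >] then box p else set0).
  apply/seteqP; split => [x Ux|x [p _]]; last by case: asboolP => // h /h.
  have [e /= e0 eU] : exists2 e : R, 0 < e & ball x e `<=` U.
    by have /nbhs_ballP[e e0 eU] := open_nbhs_nbhs (conj oU Ux); exists e.
  have [k kP] : exists k : nat, 2 / e < k%:R.
    by exists (Num.truncn (2 / e)).+1; exact: truncnS_gt.
  have k0 : 0 < k.+1%:R^-1 :> R by rewrite invr_gt0.
  have [q qP] : exists q : 'I_n -> rat, forall i, `|x ord0 i - ratr (q i)| < k.+1%:R^-1.
    apply: (@fin_all_exists _ (fun=> rat) (fun i r => `|x ord0 i - ratr r| < k.+1%:R^-1)) => i.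
    have : x ord0 i - k.+1%:R^-1 < x ord0 i + k.+1%:R^-1 by rewrite ltrD2l gtrN.
    move=> /rat_in_itvoo[r]; rewrite in_itv/= => /andP[r1 r2]; exists r.
    by rewrite ltr_distl ltrBlDr r2/= -ltrBlDr r1.
  exists (\row_i q i, k) => //.
  case: asboolP => [_|[]]; first by move=> i /=; rewrite mxE.
  move=> y yb; apply: eU; split => // i j.
  rewrite (ord1 i) /ball/=; have := yb j; rewrite /= mxE => yj.
  have -> : x ord0 j - y ord0 j = (x ord0 j - ratr (q j)) - (y ord0 j - ratr (q j)) by ring.
  apply: (le_lt_trans (ler_normB _ _)); apply: (lt_trans (ltrD (qP j) yj)).
  have k2 : k.+1%:R^-1 < e / 2.
    rewrite -[e / 2]invf_div ltf_pV2 ?posrE ?divr_gt0//.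
    by rewrite (lt_trans kP)// ltr_nat.
  by rewrite [ltRHS]splitr ltrD.
by apply: countable_bigcupT_measurable => // p; case: asboolP.
Qed.

Lemma continuous_measurable_rV n (f : 'rV[R]_n -> R) :
  continuous f -> measurable_fun setT f.
Proof.
move=> /continuousP cf; apply: (measurability _ (@RGenOpens.measurableE R)) => //.
move=> _ [_ [a [b ->] <-]]; rewrite setTI.
by apply: open_measurable_rV; apply: cf; exact: interval_open.
Qed.

Lemma coord_le_norm n (x : 'rV[R]_n) i : `|x ord0 i| <= `|x|.
Proof.
rewrite [leRHS]/Num.norm/= mx_normrE.
exact: (le_bigmax _ (fun j : 'I_1 * 'I_n => `|x j.1 j.2|) (ord0, i)).
Qed.

Lemma measurable_box_rV k (M : R) :
  measurable [set x : 'rV[R]_k | forall i, `|x ord0 i| <= M].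
Proof.
rewrite [X in measurable X](_ : _ = \bigcap_(i in [set: 'I_k]) [set x : 'rV[R]_k | `|x ord0 i| <= M]); last first.
  by apply/seteqP; split => [x h i _|x h i]; [exact: h|exact: (h i)].
apply: fin_bigcap_measurable => // i _.
rewrite [X in measurable X](_ : _ =
   setT `&` (fun x : 'rV[R]_k => x ord0 i : measurableTypeR R) @^-1`
     `[- M, M]%classic); last first.
  by rewrite setTI; apply/seteqP; split => x /=; rewrite in_itv/= ler_norml.
by apply: measurable_coord.
Qed.

Lemma lebesgue_rV_box n (M : R) :
  (lebesgue_rV R n [set x | forall i, (`|x ord0 i| <= M)%R] < +oo)%E.
Proof.
elim: n => [|n IH]; first by rewrite /= diracE ltry.
set box := fun n => [set x : 'rV[R]_n | forall i, `|x ord0 i| <= M].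
have mbox k : measurable (box k) by exact: measurable_box_rV.
have -> : lebesgue_rV R n.+1 (box n.+1) =
    (lebesgue_measure \x lebesgue_rV R n)%E (`[(- M)%R, M]%classic `*` box n).
  rewrite /= /step_measure /pushforward; congr (_ _).
  apply/seteqP; split => [[a y] /= h|[a y] /= [/= ha hy] i].
    split => [|i]; rewrite /= ?in_itv/= -?ler_norml.
      by have := h ord0; rewrite mxE unlift_none.
    by have := h (lift ord0 i); rewrite mxE liftK.
  rewrite mxE; case: unliftP => [j _|_]; first exact: hy.
  by move: ha; rewrite /= in_itv/= ler_norml.
rewrite product_measure1E//; last exact: mbox.
rewrite lte_mul_pinfty//.
suff : (@lebesgue_measure R `[(- M)%R, M]%classic) \is a fin_num by [].
by rewrite lebesgue_measure_itv; case: ifPn.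
Qed.

Lemma lebesgue_rV_bounded n (A : set 'rV[R]_n) :
  measurable A -> bounded_set A -> (lebesgue_rV R n A < +oo)%E.
Proof.
move=> mA [M [_ AM]]; apply: le_lt_trans (lebesgue_rV_box n (M + 1)).
apply: le_measure; rewrite ?inE//; first exact: measurable_box_rV.
move=> x Ax i; have := AM (M + 1); rewrite ltrDl ltr01 => /(_ isT x Ax).
exact: le_trans (coord_le_norm x i).
Qed.

End lebesgue_measure_rV.

(** * The inner product of L^2 *)

(** The nonnegativity of a quadratic form in this shape gives the Cauchy-Schwarz
    inequality for functions and for vector fields alike. *)
Lemma discriminant_le (R : realType) (a b c : R) : 0 <= c ->
  (forall r, 0 <= a - 2 * r * b + r ^+ 2 * c) -> b ^+ 2 <= a * c.
Proof.
rewrite le_eqVlt => /predU1P[<-|c0] H.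
  rewrite mulr0; have [->|b0] := eqVneq b 0; first by rewrite expr0n.
  have := H ((a + 1) / (2 * b)).
  have -> : a - 2 * ((a + 1) / (2 * b)) * b + ((a + 1) / (2 * b)) ^+ 2 * 0 = -1.
    by field.
  by rewrite lerNr oppr0 ler10.
have := H (b / c).
have -> : a - 2 * (b / c) * b + (b / c) ^+ 2 * c = (a * c - b ^+ 2) / c.
  by field; rewrite gt_eqF.
by rewrite pmulr_lge0 ?invr_gt0// subr_ge0.
Qed.

Section L2.
Context {R : realType} {n : nat}.
Local Notation X := 'rV[R]_n.+1.
Local Notation dx := (@lebesgue_rV R n.+1).
Variable Om : set X.
Hypothesis mOm : measurable Om.
Implicit Types (f g h : X -> R) (G H : X -> X).

Definition ip f g : R := \int[dx]_(x in Om) (f x * g x).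

Lemma in_L2_sqr f : in_Lp 2 Om f -> dx.-integrable Om (EFin \o (fun x => f x ^+ 2)).
Proof.
by move=> [_]; apply: eq_integrable => // x _ /=; rewrite real_normK ?num_real.
Qed.

Lemma in_L2_intro f : measurable_fun Om f ->
  dx.-integrable Om (EFin \o (fun x => f x ^+ 2)) -> in_Lp 2 Om f.
Proof.
move=> mf fi; split => //; move: fi.
by apply: eq_integrable => // x _ /=; rewrite real_normK ?num_real.
Qed.

Lemma in_L2_mul f g : in_Lp 2 Om f -> in_Lp 2 Om g ->
  dx.-integrable Om (EFin \o (fun x => f x * g x)).
Proof.
move=> fL gL; have [mf _] := fL; have [mg _] := gL.
apply: (@integrable_le_EFin _ _ _ dx _ mOm _ (fun x => f x ^+ 2 + g x ^+ 2)).
- exact: measurable_funM.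
- move=> x _; rewrite normrM -(real_normK (num_real (f x))) -(real_normK (num_real (g x))).
  have := sqr_ge0 (`|f x| - `|g x|); have := normr_ge0 (f x); have := normr_ge0 (g x).
  by move: `|f x| `|g x| => a b; nra.
- by apply: integrableD_EFin => //; exact: in_L2_sqr.
Qed.

Lemma in_L2_lin f g (a b : R) : in_Lp 2 Om f -> in_Lp 2 Om g ->
  in_Lp 2 Om (fun x => a * f x + b * g x).
Proof.
move=> fL gL; have [mf _] := fL; have [mg _] := gL.
apply: in_L2_intro.
  by apply: measurable_funD; apply: measurable_funM.
have -> : (fun x => (a * f x + b * g x) ^+ 2) = (fun x => (a ^+ 2 * f x ^+ 2 +
    (2 * a * b) * (f x * g x)) + b ^+ 2 * g x ^+ 2).
  by apply/funext => x; ring.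
apply: integrableD_EFin => //; last first.
  by apply: integrableZ_EFin => //; exact: in_L2_sqr.
apply: integrableD_EFin => //; apply: integrableZ_EFin => //; first exact: in_L2_sqr.
exact: in_L2_mul.
Qed.

Lemma eq_in_Lp p f g : {in Om, f =1 g} -> in_Lp p Om f -> in_Lp p Om g.
Proof.
move=> fg [mf fi]; split; first exact: eq_measurable_fun mf.
by apply: eq_integrable fi => // x xO; rewrite fg.
Qed.

Lemma in_L2B f g : in_Lp 2 Om f -> in_Lp 2 Om g -> in_Lp 2 Om (fun x => f x - g x).
Proof.
move=> fL gL; apply: eq_in_Lp (in_L2_lin 1 (-1) fL gL) => x _.
by rewrite mul1r mulN1r.
Qed.

Lemma in_L2D f g : in_Lp 2 Om f -> in_Lp 2 Om g -> in_Lp 2 Om (fun x => f x + g x).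
Proof.
move=> fL gL; apply: eq_in_Lp (in_L2_lin 1 1 fL gL) => x _.
by rewrite !mul1r.
Qed.

Lemma in_L2Z (a : R) f : in_Lp 2 Om f -> in_Lp 2 Om (fun x => a * f x).
Proof.
move=> fL; apply: eq_in_Lp (in_L2_lin a 0 fL fL) => x _.
by rewrite mul0r addr0.
Qed.

Lemma ipC f g : ip f g = ip g f.
Proof. by apply: eq_Rintegral => x _; rewrite mulrC. Qed.

Lemma eq_ip f f' g : {in Om, f =1 f'} -> ip f g = ip f' g.
Proof. by move=> ff; apply: eq_Rintegral => x xO; rewrite ff. Qed.

Lemma ip_linl (a b : R) f g h : in_Lp 2 Om f -> in_Lp 2 Om g -> in_Lp 2 Om h ->
  ip (fun x => a * f x + b * g x) h = a * ip f h + b * ip g h.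
Proof.
move=> fL gL hL; have fh := in_L2_mul fL hL; have gh := in_L2_mul gL hL.
rewrite /ip -RintegralZl// -RintegralZl// -RintegralD//; [|exact: integrableZ_EFin..].
by apply: eq_Rintegral => x _; ring.
Qed.

Lemma ipBl f g h : in_Lp 2 Om f -> in_Lp 2 Om g -> in_Lp 2 Om h ->
  ip (fun x => f x - g x) h = ip f h - ip g h.
Proof.
move=> fL gL hL; rewrite -[ip f h]mul1r -[- ip g h]mulN1r -ip_linl//.
by apply: eq_ip => x _; rewrite mul1r mulN1r.
Qed.

Lemma ipBr f g h : in_Lp 2 Om f -> in_Lp 2 Om g -> in_Lp 2 Om h ->
  ip h (fun x => f x - g x) = ip h f - ip h g.
Proof. by move=> fL gL hL; rewrite ipC ipBl// ![ip _ h]ipC. Qed.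

Lemma ipZl (a : R) f h : in_Lp 2 Om f -> in_Lp 2 Om h ->
  ip (fun x => a * f x) h = a * ip f h.
Proof.
move=> fL hL; rewrite -[RHS]addr0 -(mul0r (ip f h)) -ip_linl//.
by apply: eq_ip => x _; rewrite mul0r addr0.
Qed.

Lemma ip_ge0 f : 0 <= ip f f.
Proof. by apply: Rintegral_ge0 => x _; rewrite -expr2 sqr_ge0. Qed.

Lemma ip_quadratic f g (r : R) : in_Lp 2 Om f -> in_Lp 2 Om g ->
  0 <= ip f f - 2 * r * ip f g + r ^+ 2 * ip g g.
Proof.
move=> fL gL; have := ip_ge0 (fun x => 1 * f x + (- r) * g x).
have hL := in_L2_lin 1 (- r) fL gL.
rewrite ip_linl// ![ip _ (fun x => _ + _)]ipC !ip_linl// (ipC g f).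
by congr (0 <= _); ring.
Qed.

Lemma ip_CS f g : in_Lp 2 Om f -> in_Lp 2 Om g -> ip f g ^+ 2 <= ip f f * ip g g.
Proof.
by move=> fL gL; apply: discriminant_le => [|r]; [exact: ip_ge0|exact: ip_quadratic].
Qed.

Lemma normL2E f : normL2 Om f = Num.sqrt (ip f f).
Proof. by congr Num.sqrt; apply: eq_Rintegral => x _; rewrite expr2. Qed.

Lemma normL2_sqr f : normL2 Om f ^+ 2 = ip f f.
Proof. by rewrite normL2E sqr_sqrtr// ip_ge0. Qed.

Lemma normL2_ge0 f : 0 <= normL2 Om f. Proof. exact: sqrtr_ge0. Qed.

Lemma ip_norm_le f g : in_Lp 2 Om f -> in_Lp 2 Om g ->
  `|ip f g| <= normL2 Om f * normL2 Om g.
Proof.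
move=> fL gL; rewrite -(@ler_pXn2r _ 2)// ?nnegrE ?mulr_ge0 ?normL2_ge0//.
by rewrite real_normK ?num_real// exprMn !normL2_sqr; exact: ip_CS.
Qed.

Lemma normL2_triangle f g : in_Lp 2 Om f -> in_Lp 2 Om g ->
  normL2 Om f <= normL2 Om g + normL2 Om (fun x => f x - g x).
Proof.
move=> fL gL; have dL := in_L2B fL gL.
rewrite -(@ler_pXn2r _ 2)// ?nnegrE ?addr_ge0 ?normL2_ge0//.
rewrite sqrrD !normL2_sqr.
have -> : ip f f = ip g g + 2 * ip g (fun x => f x - g x) +
    ip (fun x => f x - g x) (fun x => f x - g x).
  by rewrite !(ipBl, ipBr)// (ipC g f); ring.
rewrite lerD2r lerD2l -(mulr_natl (normL2 Om g * _) 2) ler_pM2l//.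
by apply: le_trans (ip_norm_le _ _) => //; exact: ler_norm.
Qed.

Lemma ip_cvg (I : Type) (F : set_system I) (FF : Filter F) (fk : I -> X -> R) f h :
  in_Lp 2 Om f -> in_Lp 2 Om h -> (\forall k \near F, in_Lp 2 Om (fk k)) ->
  normL2 Om (fun x => fk k x - f x) @[k --> F] --> 0 ->
  ip (fk k) h @[k --> F] --> ip f h.
Proof.
move=> fL hL fkL cv; apply/cvgrPdist_le => e e0.
have c2 : normL2 Om (fun x => fk k x - f x) * normL2 Om h @[k --> F] --> 0.
  by rewrite -[X in _ --> X](mul0r (normL2 Om h)); apply: cvgM => //; exact: cvg_cst.
move/cvgr0Pnorm_le : c2 => /(_ e e0); apply: filterS2 fkL => k kL.
apply: le_trans; rewrite distrC -ipBl//; apply: (le_trans (ip_norm_le _ _)) => //.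
  exact: in_L2B.
exact: ler_norm.
Qed.

Definition vip G H : R := \sum_i ip (fun x => G x ord0 i) (fun x => H x ord0 i).

Definition in_vL2 G := forall i, in_Lp 2 Om (fun x => G x ord0 i).

Lemma in_vL2B G H : in_vL2 G -> in_vL2 H -> in_vL2 (fun x => G x - H x).
Proof.
move=> GL HL i; apply: eq_in_Lp (in_L2B (GL i) (HL i)) => x _.
by rewrite !mxE.
Qed.

Lemma sqnormL2E G : in_vL2 G -> sqnormL2 Om G = vip G G.
Proof.
move=> GL; rewrite /sqnormL2 /vip /Rintegral.
under eq_integral do rewrite -sumEFin.
rewrite integral_sum//; last by move=> i; exact: in_L2_sqr (GL i).
rewrite (eq_bigr (fun i => (ip (fun x => G x ord0 i) (fun x => G x ord0 i))%:E)).
  by rewrite sumEFin.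
move=> i _; rewrite -[LHS]fineK; last by apply: integrable_fin_num => //; exact: in_L2_sqr (GL i).
by congr (_%:E); apply: eq_Rintegral => x _; rewrite expr2.
Qed.

Lemma vipC G H : vip G H = vip H G.
Proof. by apply: eq_bigr => i _; exact: ipC. Qed.

Lemma vipBl G H K : in_vL2 G -> in_vL2 H -> in_vL2 K ->
  vip (fun x => G x - H x) K = vip G K - vip H K.
Proof.
move=> GL HL KL; rewrite /vip -sumrB; apply: eq_bigr => i _.
by rewrite -ipBl//; apply: eq_ip => x _; rewrite !mxE.
Qed.

Lemma vip_ge0 G : 0 <= vip G G.
Proof. by apply: sumr_ge0 => i _; exact: ip_ge0. Qed.

Lemma vip_CS G H : in_vL2 G -> in_vL2 H -> vip G H ^+ 2 <= vip G G * vip H H.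
Proof.
move=> GL HL; apply: discriminant_le => [|r]; first exact: vip_ge0.
rewrite /vip !mulr_sumr -sumrB -big_split/=.
by apply: sumr_ge0 => i _; exact: ip_quadratic.
Qed.

End L2.

Lemma normL2_subC {R : realType} {n : nat} (Om : set 'rV[R]_n.+1) (f g : 'rV[R]_n.+1 -> R) :
  normL2 Om (fun x => f x - g x) = normL2 Om (fun x => g x - f x).
Proof. by congr Num.sqrt; apply: eq_Rintegral => x _; rewrite -sqrrN opprB. Qed.

Lemma normL2_dist {R : realType} {n : nat} (Om : set 'rV[R]_n.+1) (f g : 'rV[R]_n.+1 -> R) :
  measurable Om -> in_Lp 2 Om f -> in_Lp 2 Om g ->
  `|normL2 Om f - normL2 Om g| <= normL2 Om (fun x => f x - g x).
Proof.
move=> mO fL gL; have t1 := normL2_triangle mO fL gL.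
have t2 := normL2_triangle mO gL fL; rewrite normL2_subC in t2.
move: t1 t2; move: (normL2 Om f) (normL2 Om g) (normL2 Om _) => a b c t1 t2.
by rewrite ler_norml; lra.
Qed.

(** * Test functions *)
Section test_functions.
Context {R : realType} {n : nat}.
Local Notation X := 'rV[R]_n.+1.
Implicit Types (f g : X -> R) (Om : set X).

Lemma class_C_continuous k f : class_C k f -> continuous f.
Proof. by case: k => [|k []]. Qed.

Lemma class_CW k f : class_C k.+1 f -> class_C k f.
Proof.
elim: k f => [|k IH] f [cf df]; first exact: cf.
by split => // i; have [d1 d2] := df i; split => //; exact: IH.
Qed.

Lemma class_CD k f g : class_C k f -> class_C k g -> class_C k (fun x => f x + g x).
Proof.
elim: k f g => [|k IH] f g.
  by move=> cf cg x; apply: continuousD; [exact: cf|exact: cg].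
move=> [cf df] [cg dg]; split; first by move=> x; apply: continuousD; [exact: cf|exact: cg].
move=> i; have [df1 df2] := df i; have [dg1 dg2] := dg i; split.
  by move=> x; apply: derivableD.
have -> : partial i (fun x => f x + g x) = fun x => partial i f x + partial i g x.
  by apply/funext => x; exact: (deriveD (df1 x) (dg1 x)).
exact: IH.
Qed.

Lemma partialM i f g : (forall x, derivable f x (delta_mx ord0 i)) ->
  (forall x, derivable g x (delta_mx ord0 i)) ->
  partial i (fun x => f x * g x) = fun x => f x * partial i g x + partial i f x * g x.
Proof.
move=> df dg; apply/funext => x; rewrite [partial i f x * _]mulrC.
exact: (deriveM (df x) (dg x)).
Qed.

Lemma class_CM k f g : class_C k f -> class_C k g -> class_C k (fun x => f x * g x).
Proof.
elim: k f g => [|k IH] f g.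
  by move=> cf cg x; apply: continuousM; [exact: cf|exact: cg].
move=> Cf Cg; have [cf df] := Cf; have [cg dg] := Cg.
split; first by move=> x; apply: continuousM; [exact: cf|exact: cg].
move=> i; have [df1 df2] := df i; have [dg1 dg2] := dg i; split.
  by move=> x; apply: derivableM.
rewrite partialM//; apply: class_CD; apply: IH => //; exact: class_CW.
Qed.

Lemma class_C_cst k (c : R) : class_C k (fun _ : X => c).
Proof.
elim: k c => [|k IH] c; first exact: cst_continuous.
split; first exact: cst_continuous.
move=> i; split; first by move=> x; exact: derivable_cst.
by have -> : partial i (fun _ : X => c) = fun=> 0 by apply/funext => x; exact: derive_cst.
Qed.

Lemma is_derive_coord (i : 'I_n.+1) (x v : X) :
  is_derive x v (fun y : X => y ord0 i) (v ord0 i).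
Proof.
have cv : (fun h : R => h^-1 *: (((fun y : X => y ord0 i) \o shift x) (h *: v) - x ord0 i))
     @ 0^' --> v ord0 i.
  apply: (@cvg_trans _ ((fun=> v ord0 i) @ (0 : R)^')); last exact: cvg_cst.
  apply: near_eq_cvg; near=> h.
  rewrite /= !mxE addrK /GRing.scale/= mulrA mulVf ?mul1r//.
  by near: h; exact: nbhs_dnbhs_neq.
split; first by apply/cvg_ex; eexists; exact: cv.
exact: cvg_lim cv.
Unshelve. all: by end_near. Qed.

Lemma class_C_coord k (i : 'I_n.+1) : class_C k (fun x : X => x ord0 i).
Proof.
case: k => [|k]; first exact: coord_continuous.
split; first exact: coord_continuous.
move=> j; split; first by move=> x; have [] := is_derive_coord i x (delta_mx ord0 j).
have -> : partial j (fun x : X => x ord0 i) = (fun=> (delta_mx ord0 j : X) ord0 i).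
  by apply/funext => x; have [_] := is_derive_coord i x (delta_mx ord0 j).
exact: class_C_cst.
Qed.

Lemma test_function_derivable Om f : test_function Om f ->
  forall i x, derivable f x (delta_mx ord0 i).
Proof. by move=> [/(_ 1%N)[_ df] _] i x; have [] := df i. Qed.

Lemma test_function_partial Om f i : test_function Om f -> test_function Om (partial i f).
Proof.
move=> [Cf [K [cK KO] f0]]; split.
  by move=> k; have [_ /(_ i)[]] := Cf k.+1.
exists K => // x Kx.
have clK : closed K by apply: compact_closed => //; exact: norm_hausdorff.
have nK : \forall y \near x, f y = (fun=> 0) y.
  have : nbhs x (~` K) by apply: open_nbhs_nbhs; split => //; exact: closed_openC.
  by apply: filterS => y; exact: f0.
rewrite /partial (near_eq_derive _ nK) ?derive_cst//.
Qed.

Lemma test_function_coordM Om f i : test_function Om f ->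
  test_function Om (fun x => x ord0 i * f x).
Proof.
move=> [Cf [K cK f0]]; split.
  by move=> k; apply: class_CM => //; exact: class_C_coord.
by exists K => // x /f0 ->; rewrite mulr0.
Qed.

Lemma in_L2_test Om f : measurable Om -> bounded_set Om -> test_function Om f ->
  in_Lp 2 Om f.
Proof.
move=> mO bO [Cf [K [cK KO] f0]].
have cf : continuous f by exact: class_C_continuous (Cf 0%N).
have mf : measurable_fun Om f.
  by apply: measurable_funTS; exact: continuous_measurable_rV.
have [M fM] : exists M : R, forall x, `|f x| <= M.
  have [K0|/set0P K0] := eqVneq K set0.
    by exists 0 => x; rewrite f0 ?normr0// K0.
  have [|c cK' cmax] := @EVT_max_rV _ _ (fun x => `|f x|) K K0 cK.
    by apply: continuous_subspaceT => x; exact: (cvg_norm (cf x)).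
  exists `|f c| => x; have [Kx|Kx] := pselect (K x); first by apply: cmax; rewrite inE.
  by rewrite f0 ?normr0.
apply: in_L2_intro => //; apply: measurable_bounded_integrable => //.
- exact: lebesgue_rV_bounded.
- exact: measurable_funX.
- exists (M ^+ 2); split; first exact: num_real.
  move=> y My x _ /=; rewrite normrX (le_trans _ (ltW My))//.
  by rewrite ler_pXn2r ?nnegrE// (le_trans _ (fM x)).
Qed.

End test_functions.

Lemma cvg_sum_seq (R : realType) (J I : Type) (A : set_system J) (FA : Filter A)
    (s : seq I) (F : I -> J -> R) (l : I -> R) :
  (forall i, F i k @[k --> A] --> l i) ->
  \sum_(i <- s) F i k @[k --> A] --> \sum_(i <- s) l i.
Proof.
move=> Fl; elim: s => [|i s IH].
  by rewrite big_nil; under eq_fun do rewrite big_nil; exact: cvg_cst.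
by rewrite big_cons; under eq_fun do rewrite big_cons; exact: cvgD.
Qed.

(** * Green's formula and the Poincare inequality *)

(** The algebra of the Poincare inequality, with V = |v|^2, c = (G_0, x_0 v),
    g = |G_0|^2, x = |x_0 v|^2 and A = |G|^2: then V^2 = 4 c^2 <= 4 A B V, and one
    factor V is cancelled. *)
Lemma absorb_square (R : realType) (V c g x A B : R) : V = - 2 * c ->
  c ^+ 2 <= g * x -> x <= B * V -> g <= A -> 0 <= V -> 0 <= g -> 0 <= B ->
  V <= 4 * B * A.
Proof.
move=> Vc cgx xBV gA V0 g0 B0.
have h : V * V <= (4 * B * A) * V.
  have -> : V * V = 4 * c ^+ 2 by rewrite Vc; ring.
  have h1 : g * x <= g * (B * V) by rewrite ler_wpM2l.
  have h2 : g * (B * V) <= A * (B * V) by rewrite ler_wpM2r// mulr_ge0.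
  have -> : 4 * B * A * V = 4 * (A * (B * V)) by ring.
  by rewrite ler_wpM2l// (le_trans cgx)// (le_trans h1).
have [->|V1] := eqVneq V 0; first by rewrite !mulr_ge0// (le_trans g0).
by rewrite -(@ler_pM2r _ V)// lt_neqAle eq_sym V1.
Qed.

Section dirichlet.
Context {R : realType} {n : nat}.
Local Notation X := 'rV[R]_n.+1.
Local Notation dx := (@lebesgue_rV R n.+1).
Variable Om : set X.
Hypotheses (mOm : measurable Om) (bOm : bounded_set Om).
Implicit Types (f v w : X -> R) (G : X -> X).

Lemma in_L2_partial f i : test_function Om f -> in_Lp 2 Om (partial i f).
Proof. by move=> tf; apply: in_L2_test => //; exact: test_function_partial. Qed.

Lemma weak_gradient_laplacian w Gw Lw f : weak_gradient Om w Gw ->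
  weak_laplacian Om w Lw -> test_function Om f ->
  ip Om Lw f = - \sum_i ip Om (fun x => Gw x ord0 i) (partial i f).
Proof.
move=> [wL GwL gP] [_ LwL lP] tf.
rewrite -[LHS]lP//.
have -> : \int[dx]_(x in Om) (w x * laplacian f x) =
    \sum_i ip Om w (partial i (partial i f)).
  rewrite /Rintegral; under eq_integral do rewrite /laplacian mulr_sumr -sumEFin.
  have iw i : dx.-integrable Om (EFin \o (fun x => w x * partial i (partial i f) x)).
    by apply: in_L2_mul => //; apply: in_L2_partial; exact: test_function_partial.
  rewrite integral_sum//.
  rewrite (eq_bigr (fun i => (ip Om w (partial i (partial i f)))%:E)) ?sumEFin//.
  by move=> i _; rewrite /ip /Rintegral fineK//; apply: integrable_fin_num => //; exact: iw.
rewrite -sumrN; apply: eq_bigr => i _.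
by apply: gP; exact: test_function_partial.
Qed.

(** For test functions in place of v this is the definition of the
    distributional derivatives; both sides are continuous in v for the H^1
    norm, in which test functions approximate v. *)
Lemma green v Gv w Gw Lw : in_H10 Om v Gv -> weak_gradient Om w Gw ->
  weak_laplacian Om w Lw -> vip Om Gw Gv = - ip Om Lw v.
Proof.
move=> [[vL GvL _] [f tf [fv fG]]] gw lw.
have [wL GwL _] := gw; have [_ LwL _] := lw.
have fL : \forall k \near \oo, in_Lp 2 Om (f k).
  by apply: nearW => k; exact: in_L2_test.
have c1 : ip Om Lw (f k) @[k --> \oo] --> ip Om Lw v.
  under eq_fun do rewrite ipC.
  by rewrite ipC; apply: ip_cvg.
have c2 : - \sum_i ip Om (fun x => Gw x ord0 i) (partial i (f k)) @[k --> \oo]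
    --> - vip Om Gw Gv.
  apply: cvgN; apply: cvg_sum_seq => i.
  under eq_fun do rewrite ipC.
  rewrite ipC; apply: ip_cvg => //.
  by apply: nearW => k; exact: in_L2_partial.
have e k : ip Om Lw (f k) = - \sum_i ip Om (fun x => Gw x ord0 i) (partial i (f k)).
  exact: (weak_gradient_laplacian gw lw).
have c3 : - \sum_i ip Om (fun x => Gw x ord0 i) (partial i (f k)) @[k --> \oo]
    --> ip Om Lw v by under eq_fun do rewrite -e.
by have := cvg_unique (@Rhausdorff R) c2 c3 => <-; rewrite opprK.
Qed.

Lemma in_L2_coordM v i : in_Lp 2 Om v -> in_Lp 2 Om (fun x => x ord0 i * v x).
Proof.
move=> vL; have [mv _] := vL; have [M [_ OM]] := bOm.
have mc : measurable_fun Om (fun x : X => x ord0 i).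
  by apply: measurable_funTS; exact: measurable_coord.
apply: in_L2_intro => //; first exact: measurable_funM.
apply: (@integrable_le_EFin _ _ _ dx _ mOm _ (fun x => (`|M| + 1) ^+ 2 * v x ^+ 2)).
- by apply: measurable_funX; exact: measurable_funM.
- move=> x Ox; rewrite ger0_norm ?sqr_ge0// exprMn.
  rewrite ler_wpM2r ?sqr_ge0// -(real_normK (num_real (x ord0 i))).
  rewrite ler_pXn2r ?nnegrE ?addr_ge0//; apply: (le_trans (coord_le_norm x i)).
  apply: OM => //; rewrite (le_lt_trans (ler_norm M))// ltrDl//.
- by apply: integrableZ_EFin => //; exact: in_L2_sqr.
Qed.

(** The gradient identity of v tested against x_0 f_k, where f_k -> v in H^1, gives
    in the limit int v^2 = - 2 int x_0 v G_0. By Cauchy-Schwarz and the bound of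
    x_0 on the bounded set Om, the right-hand side is at most 2 B |v| |G|. *)
Lemma poincare : exists2 C : R, 0 <= C &
  forall v G, in_H10 Om v G -> ip Om v v <= C * vip Om G G.
Proof.
have [M [_ OM]] := bOm; pose B := `|M| + 1.
have B0 : 0 <= B by rewrite addr_ge0.
exists (4 * B ^+ 2); first by rewrite mulr_ge0// sqr_ge0.
move=> v G [[vL GL gP] [f tf [fv fG]]].
pose xv := fun x : X => x ord0 ord0 * v x.
pose G0 := fun x : X => G x ord0 ord0.
have xvL : in_Lp 2 Om xv by exact: in_L2_coordM.
have xGL : in_Lp 2 Om (fun x => x ord0 ord0 * G0 x) by exact: in_L2_coordM (GL _).
have fL k : in_Lp 2 Om (f k) by exact: in_L2_test.
have pfL k : in_Lp 2 Om (partial ord0 (f k)) by exact: in_L2_partial.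
have e k : ip Om (f k) v + ip Om (partial ord0 (f k)) xv =
    - ip Om (f k) (fun x => x ord0 ord0 * G0 x).
  have -> : ip Om (f k) (fun x => x ord0 ord0 * G0 x) =
      ip Om G0 (fun x => x ord0 ord0 * f k x).
    by apply: eq_Rintegral => x _; ring.
  rewrite -[RHS]gP; last exact: test_function_coordM.
  rewrite partialM; last 2 first.
    - by move=> x; have [] := is_derive_coord ord0 x (delta_mx ord0 ord0).
    - exact: test_function_derivable.
  rewrite -RintegralD//; [|exact: in_L2_mul..].
  apply: eq_Rintegral => x _.
  have [_ d1] := is_derive_coord ord0 x (delta_mx ord0 ord0 : X).
  rewrite {3}/partial d1 mxE !eqxx mul1r /xv; ring.
have c1 : ip Om (f k) v + ip Om (partial ord0 (f k)) xv @[k --> \oo] -->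
    ip Om v v + ip Om G0 xv.
  apply: cvgD; first by apply: ip_cvg => //; exact: nearW.
  by apply: ip_cvg => //; [exact: GL|exact: nearW].
have c2 : - ip Om (f k) (fun x => x ord0 ord0 * G0 x) @[k --> \oo] -->
    - ip Om v (fun x => x ord0 ord0 * G0 x).
  by apply: cvgN; apply: ip_cvg => //; exact: nearW.
have c3 : ip Om (f k) v + ip Om (partial ord0 (f k)) xv @[k --> \oo] -->
    - ip Om v (fun x => x ord0 ord0 * G0 x) by under eq_fun do rewrite e.
have : ip Om v v + ip Om G0 xv = - ip Om v (fun x => x ord0 ord0 * G0 x).
  exact: (cvg_unique (@Rhausdorff R) c1 c3).
have -> : ip Om v (fun x => x ord0 ord0 * G0 x) = ip Om G0 xv.
  by apply: eq_Rintegral => x _; rewrite /xv; ring.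
move=> eq2; have vv : ip Om v v = - 2 * ip Om G0 xv by lra.
have CS := ip_CS mOm (GL ord0) xvL; rewrite -/G0 in CS.
have xvB : ip Om xv xv <= B ^+ 2 * ip Om v v.
  rewrite -RintegralZl//; last exact: in_L2_mul.
  apply: le_Rintegral => //; first exact: in_L2_mul.
    by apply: integrableZ_EFin => //; exact: in_L2_mul.
  move=> x Ox; rewrite /xv -!expr2 exprMn ler_wpM2r ?sqr_ge0//.
  rewrite -(real_normK (num_real (x ord0 ord0))).
  rewrite ler_pXn2r ?nnegrE//; apply: (le_trans (coord_le_norm x _)).
  by apply: OM => //; rewrite (le_lt_trans (ler_norm M))// ltrDl.
have GG : ip Om G0 G0 <= vip Om G G.
  by rewrite /vip (bigD1 ord0)//= lerDl; apply: sumr_ge0 => i _; exact: ip_ge0.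
have v0 := ip_ge0 Om v.
have G00 := ip_ge0 Om G0.
by apply: (absorb_square vv CS xvB GG) => //; exact: sqr_ge0.
Qed.

Lemma in_H10B v G w H : in_H10 Om v G -> in_H10 Om w H ->
  in_H10 Om (fun x => v x - w x) (fun x => G x - H x).
Proof.
move=> [[vL GL gP] [f tf [fv fG]]] [[wL HL hP] [g tg [gw gH]]].
split; first split.
- exact: in_L2B.
- exact: in_vL2B.
- move=> h i th; have pL := in_L2_partial i th; have hL := in_L2_test mOm bOm th.
  have := ipBl mOm vL wL pL; rewrite [in X in _ = X -> _]/ip gP// hP// => e.
  apply: (etrans e).
  have -> : \int[dx]_(x in Om) ((G x - H x) ord0 i * h x) =
      ip Om (fun x => G x ord0 i - H x ord0 i) h.
    by apply: eq_Rintegral => x _; rewrite !mxE.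
  by rewrite ipBl// opprB opprK addrC.
have fL k : in_Lp 2 Om (f k) by exact: in_L2_test.
have gL k : in_Lp 2 Om (g k) by exact: in_L2_test.
have key a b a' b' : in_Lp 2 Om a -> in_Lp 2 Om b -> in_Lp 2 Om a' -> in_Lp 2 Om b' ->
    normL2 Om (fun x => (a x - a' x) - (b x - b' x)) <=
    normL2 Om (fun x => a x - b x) + normL2 Om (fun x => a' x - b' x).
  move=> aL bL aL' bL'.
  pose p x := a x - b x; pose q x := a' x - b' x.
  have pL : in_Lp 2 Om p by exact: in_L2B.
  have qL : in_Lp 2 Om q by exact: in_L2B.
  have -> : (fun x => (a x - a' x) - (b x - b' x)) = (fun x => p x - q x).
    by apply/funext => x; rewrite /p /q; ring.
  have := normL2_triangle mOm (in_L2B mOm pL qL) pL.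
  rewrite (_ : normL2 Om (fun x => p x - q x - p x) = normL2 Om q)//.
  by congr Num.sqrt; apply: eq_Rintegral => x _; rewrite addrAC subrr sub0r sqrrN.
exists (fun k x => f k x - g k x).
  move=> k; have [Cf [K [cK KO] f0]] := tf k; have [Cg [K' [cK' KO'] g0]] := tg k.
  split.
    move=> m.
    have -> : (fun x => f k x - g k x) = (fun x => f k x + (- 1) * g k x).
      by apply/funext => x; rewrite mulN1r.
    by apply: class_CD => //; apply: class_CM => //; exact: class_C_cst.
  exists (K `|` K'); first by split; [exact: compactU|move=> x [/KO|/KO']].
  by move=> x /not_orP[/f0 -> /g0 ->]; rewrite subrr.
split.
  apply: (squeeze_cvgr _ (cvg_cst 0)); last by rewrite -[X in _ --> X]addr0; exact: (cvgD fv gw).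
  by apply: nearW => k; rewrite normL2_ge0/=; exact: key.
move=> i.
apply: (squeeze_cvgr _ (cvg_cst 0)); last by rewrite -[X in _ --> X]addr0; exact: (cvgD (fG i) (gH i)).
apply: nearW => k; rewrite normL2_ge0/=.
rewrite (_ : normL2 _ _ = normL2 Om (fun x => (partial i (f k) x - partial i (g k) x) -
   (G x ord0 i - H x ord0 i))); first by apply: key => //; exact: in_L2_partial.
congr Num.sqrt; apply: eq_Rintegral => x _; rewrite !mxE; congr ((_ - _) ^+ 2).
by apply: deriveB; exact: test_function_derivable.
Qed.

End dirichlet.

(** * Measurability in space and time *)
Lemma floor_grid_dist (R : realType) (tau : R) (k : nat) :
  `|tau - (Num.floor (tau * k.+1%:R))%:~R / k.+1%:R| <= k.+1%:R^-1.
Proof.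
have k0 : 0 < k.+1%:R :> R by rewrite ltr0n.
have /andP[] := floor_itv (tau * k.+1%:R); rewrite intrD.
move: (k.+1%:R) k0 => q k0; move: (Num.floor (tau * q)) => z h1 h2.
have -> : tau - z%:~R / q = (tau * q - z%:~R) / q by field; rewrite gt_eqF.
rewrite normrM normfV (gtr0_norm k0) ger0_norm ?subr_ge0//.
by rewrite ler_piMl ?invr_ge0 ?(ltW k0)// lerBlDl (ltW h2).
Qed.

Section joint_measurability.
Context {R : realType} d (Y : measurableType d).
Implicit Types (g : R -> Y -> R) (a b : R).

(** Rounding the time down to multiples of 1/(k + 1) gives countably many slabs, on
    each of which the function depends on y only; continuity in time makes
    these approximations converge. *)
Lemma measurable_caratheodory g a b : (forall tau, measurable_fun setT (g tau)) ->
  (forall y tau, tau \in `]a, b[ -> {for tau, continuous (g ^~ y)}) ->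
  measurable_fun (`]a, b[%classic `*` setT)
    (fun p : measurableTypeR R * Y => g p.1 p.2).
Proof.
move=> mg cg.
pose rho (k : nat) (tau : R) : R := (Num.floor (tau * k.+1%:R))%:~R / k.+1%:R.
have k0 k : 0 < k.+1%:R :> R by rewrite ltr0n.
apply: (@measurable_fun_cvg _ _ _ _ (fun k (p : measurableTypeR R * Y) => g (rho k p.1) p.2)).
  move=> k; apply: measurable_funTS => _ B mB; rewrite setTI.
  have -> : (fun p : measurableTypeR R * Y => g (rho k p.1) p.2) @^-1` B =
    \bigcup_(z in [set: int]) (`[z%:~R / k.+1%:R, (z + 1)%:~R / k.+1%:R[%classic `*`
        (g (z%:~R / k.+1%:R) @^-1` B)).
    apply/seteqP; split => [[tau y] /= h|[tau y] [z _] /= [/=]].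
      exists (Num.floor (tau * k.+1%:R)) => //; split => //=.
      by rewrite in_itv/= ler_pdivrMr// ltr_pdivlMr// floor_itv.
    rewrite in_itv/= ler_pdivrMr// ltr_pdivlMr// => h.
    have {}h : Num.floor (tau * k.+1%:R) = z by apply: floor_def.
    by rewrite /rho h.
  apply: countable_bigcupT_measurable => // z; apply: measurableX => //.
  by rewrite -[X in measurable X]setTI; exact: mg.
move=> [tau y] [/= tauab _].
have cv : rho k tau @[k --> \oo] --> tau.
  apply/cvgrPdist_le => e e0.
  have := @cvg_harmonic R => /cvgr0Pnorm_le/(_ e e0); apply: filterS => k.
  rewrite ger0_norm ?invr_ge0// => /(le_trans _); apply.
  exact: floor_grid_dist.
exact: (cvg_comp _ _ cv (cg y tau tauab)).
Qed.

(** The derivative is a limit of difference quotients of g, which is jointly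
    measurable by [measurable_caratheodory]. *)
Lemma measurable_derive1_uncurry g a b : (forall tau, measurable_fun setT (g tau)) ->
  (forall y tau, tau \in `]a, b[ -> derivable (g ^~ y) tau 1) ->
  measurable_fun (`]a, b[%classic `*` setT)
    (fun p : measurableTypeR R * Y => derive1 (g ^~ p.2) p.1).
Proof.
move=> mg dg.
have mD : measurable (`]a, b[%classic `*` setT : set (measurableTypeR R * Y)).
  exact: measurableX.
have mgu := @measurable_caratheodory g a b mg _.
(* extended by zero, so that the quotient makes sense when tau + e k > b; for
   a given tau this happens for finitely many k only *)
pose G := (fun p : measurableTypeR R * Y => g p.1 p.2) \_ (`]a, b[%classic `*` setT).
have mG : measurable_fun setT G.
  apply/measurable_restrict => //; rewrite setTI; apply: mgu => y tau tab.
  by apply: differentiable_continuous; apply/derivable1_diffP; exact: dg.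
pose e (k : nat) : R := k.+1%:R^-1.
have e0 k : 0 < e k by rewrite invr_gt0.
apply: (@measurable_fun_cvg _ _ _ _ (fun k (p : measurableTypeR R * Y) =>
   (e k)^-1 * (G (e k + p.1, p.2) - G p))).
  move=> k; apply: measurable_funTS; apply: measurable_funM => //.
  apply: measurable_funB => //; apply: (measurableT_comp mG).
  apply/measurable_fun_pair => /=; last exact: measurable_snd.
  by apply: measurable_funD => //; exact: measurable_fst.
move=> [tau y] [/= tauab _].
have ce : e k @[k --> \oo] --> (0 : R)^'.
  have := @cvg_harmonic R => c A [r /= r0 rA].
  move/cvgr0Pnorm_lt : c => /(_ r r0); apply: filterS => k ke.
  apply: rA => /=; first by rewrite sub0r normrN.
  by rewrite gt_eqF.
have dgt := dg y tau tauab.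
have c1 : (e k)^-1 * (g (e k + tau) y - g tau y) @[k --> \oo] --> derive1 (g ^~ y) tau.
  have := dgt; rewrite /derivable => c.
  have c2 : (fun h : R => h^-1 *: (((g ^~ y) \o shift tau) (h *: 1) - g tau y)) @ 0^' --> derive1 (g ^~ y) tau.
    by rewrite derive1E; exact: c.
  have := cvg_comp _ _ ce c2; apply: cvg_trans; apply: near_eq_cvg; apply: nearW => k.
  by rewrite /= /GRing.scale/= mulr1.
apply: cvg_trans c1; apply: near_eq_cvg.
have nb : \forall k \near \oo, e k < b - tau.
  have := @cvg_harmonic R => /cvgr0Pnorm_lt/(_ (b - tau)).
  move: tauab; rewrite in_itv/= => /andP[_ tb]; rewrite subr_gt0 => /(_ tb).
  by apply: filterS => k; apply: le_lt_trans; exact: ler_norm.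
apply: filterS nb => k kb.
rewrite /G !patchE !mem_set//= in_itv/=.
move: tauab; rewrite in_itv/= => /andP[ta tb].
by rewrite (lt_trans ta)/= ?ltrDr// -ltrBrDr.
Qed.

End joint_measurability.

(** * Exchanging the time and space integrals *)
Section swap.
Context {R : realType} d (Y : measurableType d).
Context (m : {sigma_finite_measure set Y -> \bar R}).
Notation mu := (@lebesgue_measure R).
Variables (A : set (measurableTypeR R)) (B : set Y) (F : R -> Y -> R) (N : R -> R).
Hypotheses (mA : measurable A) (mB : measurable B).
Hypothesis mF : measurable_fun (A `*` B) (fun p : measurableTypeR R * Y => F p.1 p.2).
Hypothesis iF : forall tau, A tau -> m.-integrable B (EFin \o F tau).
Hypothesis FN : forall tau, A tau -> \int[m]_(y in B) `|F tau y| <= N tau.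
Hypothesis iN : mu.-integrable A (EFin \o N).

(* The extension by zero reduces everything to integrals over the whole
   product space; FN and iN say that it is integrable there. *)
Let f := (EFin \o (fun p : measurableTypeR R * Y => F p.1 p.2)) \_ (A `*` B).

Let mf : measurable_fun setT f.
Proof.
apply/measurable_restrict => //; first exact: measurableX.
by rewrite setTI; apply/measurable_EFinP.
Qed.

Let fE1 tau : (\int[m]_y f (tau, y) = ((fun tau => (\int[m]_(y in B) F tau y)%R%:E) \_ A) tau)%E.
Proof.
rewrite patchE; case: ifPn => [/set_mem At|/negP nAt].
  rewrite /Rintegral fineK; last by apply: integrable_fin_num => //; exact: iF.
  rewrite [RHS]integral_mkcond; apply: eq_integral => y _.
  rewrite /f !patchE; case: ifPn => [/set_mem[_ By]|nB]; first by rewrite mem_set.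
  by case: ifPn => // /set_mem By; case/negP: nB; rewrite inE.
apply: integral0_eq => y _; rewrite /f patchE ifF//; apply/negP => /set_mem[At _].
by apply: nAt; rewrite inE.
Qed.

Let fE2 y : B y -> (fun tau => f (tau, y)) = (EFin \o F ^~ y) \_ A.
Proof.
move=> By; apply/funext => tau; rewrite /f !patchE; case: ifPn => [/set_mem[At _]|nAB].
  by rewrite mem_set.
by case: ifPn => // /set_mem At; case/negP: nAB; rewrite inE.
Qed.

Let fE3 y : ~ B y -> (fun tau => f (tau, y)) = cst 0%E.
Proof.
by move=> nB; apply/funext => tau; rewrite /f patchE ifF//; apply/negP => /set_mem[_ /nB].
Qed.

Let intf : (mu \x m)%E.-integrable setT f.
Proof.
apply/(integrable12ltyP mu m mf).
apply: (@le_lt_trans _ _ (\int[mu]_(tau in A) (N tau)%:E)%E); last exact: integrable_lty.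
rewrite [leRHS]integral_mkcond; apply: ge0_le_integral => //.
- by move=> x _; apply: integral_ge0 => y _; exact: abse_ge0.
- apply: (@measurable_fun_fubini_tonelli_F _ _ _ _ _ m (abse \o f)) => //.
    exact: measurableT_comp.
  by move=> x; exact: abse_ge0.
- by apply/measurable_restrict => //; rewrite setTI; exact: (measurable_int mu).
move=> tau _; rewrite patchE; case: ifPn => [/set_mem At|nA]; last first.
  rewrite integral0_eq// => y _; rewrite /f patchE ifF ?abse0//.
  by apply/negP => /set_mem[/mem_set At _]; rewrite At in nA.
have -> : (\int[m]_y `|f (tau, y)| = (\int[m]_(y in B) `|F tau y|)%R%:E)%E.
  rewrite /Rintegral fineK; last first.
    by apply: integrable_fin_num => //; exact: integrable_norm (iF At).
  rewrite [RHS]integral_mkcond; apply: eq_integral => y _.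
  rewrite /f !patchE; case: ifPn => [/set_mem[_ By]|nB]; first by rewrite mem_set.
  by rewrite abse0; case: ifPn => // /set_mem By; case/negP: nB; rewrite inE.
by rewrite lee_fin; exact: FN.
Qed.

Lemma integrable_Rintegral_param :
  mu.-integrable A (EFin \o (fun tau => \int[m]_(y in B) F tau y)).
Proof.
have := integrable_fubini_F intf; rewrite /fubini_F.
under eq_fun do rewrite fE1.
by move/(integrable_mkcond _ mA).
Qed.

Lemma ae_integrable_param :
  {ae m, forall y, B y -> mu.-integrable A (EFin \o F ^~ y)}.
Proof.
have := ae_integrable2 intf; apply: filterS => y h By.
by move: h; rewrite fE2//; move/(integrable_mkcond _ mA).
Qed.

Lemma measurable_Rintegral_param :
  measurable_fun B (fun y => \int[mu]_(tau in A) F tau y).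
Proof.
have mG := measurable_fubini_G intf; rewrite /fubini_G in mG.
have -> : (fun y => \int[mu]_(tau in A) F tau y) =
    (fun y => fine (\int[mu]_(tau in A) (F tau y)%:E)%E) by [].
apply: (measurableT_comp (@fine_measurable R setT _)) => //.
have : measurable_fun B (fun y => \int[mu]_tau f (tau, y))%E by apply: measurable_funTS.
apply: eq_measurable_fun => y; rewrite inE => By.
by rewrite fE2// [RHS]integral_mkcond.
Qed.

Lemma integrable_Rintegral_param_swap :
  m.-integrable B (EFin \o (fun y => \int[mu]_(tau in A) F tau y)).
Proof.
have iG : m.-integrable B (fun y => \int[mu]_tau f (tau, y))%E.
  apply: (@integrableS _ _ _ _ setT) => //; apply/integrableP; split.
    exact: measurable_fubini_G intf.
  apply: le_lt_trans ((integrable21ltyP mu m mf).1 intf).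
  apply: ge0_le_integral => //.
  - by apply: measurableT_comp => //; exact: measurable_fubini_G intf.
  - apply: (@measurable_fun_fubini_tonelli_G _ _ _ _ _ mu (abse \o f)) => //.
      exact: measurableT_comp.
    by move=> x; exact: abse_ge0.
  - move=> y _; apply: le_abse_integral => //.
    by apply: (measurableT_comp mf); exact: measurable_pair2.
apply: le_integrable iG => //; first by apply/measurable_EFinP; exact: measurable_Rintegral_param.
move=> y By /=; rewrite fE2// -integral_mkcond /Rintegral.
by case: (integral _ _ _) => [r| |]//=; rewrite normr0 leey.
Qed.

Lemma Rintegral_swap :
  \int[mu]_(tau in A) \int[m]_(y in B) F tau y =
  \int[m]_(y in B) \int[mu]_(tau in A) F tau y.
Proof.
have := Fubini intf.
under eq_integral do rewrite fE1.
rewrite -integral_mkcond => h; rewrite [LHS]/Rintegral h /Rintegral; congr fine.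
rewrite [RHS]integral_mkcond; apply: ae_eq_integral => //.
- exact: measurable_fubini_G intf.
- by apply/measurable_restrict => //; rewrite setTI; apply/measurable_EFinP; exact: measurable_Rintegral_param.
have := ae_integrable_param; apply: filterS => y iy _; rewrite patchE.
case: ifPn => [/set_mem By|nB].
  rewrite fE2// -integral_mkcond /Rintegral fineK//.
  by apply: integrable_fin_num => //; exact: iy.
by rewrite fE3 ?integral0//; move=> By; move: nB; rewrite mem_set.
Qed.

End swap.

(** * Time regularity and the Caputo derivative *)
Section time_regularity.
Context {R : realType} {n : nat}.
Local Notation X := 'rV[R]_n.+1.
Local Notation dx := (@lebesgue_rV R n.+1).
Notation mu := (@lebesgue_measure R).
Variables (Om : set X) (T : R) (u : R -> X -> R).
Hypothesis mOm : measurable Om.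
Hypothesis u_L2 : forall t : R, 0 <= t <= T -> in_Lp 2 Om (u t).
Hypothesis u_cont : continuous_Lp 2 Om `[0, T] u.
Hypothesis u_reg : time_regular Om T u.

Lemma ip_normr2 (f : X -> R) : \int[dx]_(x in Om) `|f x| ^+ 2 = ip Om f f.
Proof. by apply: eq_Rintegral => x _; rewrite real_normK ?num_real// expr2. Qed.

Lemma normL2_cvg0 (I : Type) (F : set_system I) (FF : Filter F) (f : I -> X -> R) :
  \int[dx]_(x in Om) `|f k x| ^+ 2 @[k --> F] --> 0 -> normL2 Om (f k) @[k --> F] --> 0.
Proof.
under eq_fun do rewrite ip_normr2.
move=> h; under eq_fun do rewrite normL2E.
have := @sqrt_continuous R 0; rewrite /continuous_at sqrtr0 => s0.
exact: (cvg_comp _ _ h s0).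
Qed.

Lemma partial_t_L2 t : 0 < t < T -> in_Lp 2 Om (partial_t u t).
Proof. by move=> tT; have [_ /(_ _ tT)[]] := u_reg. Qed.

Lemma near_in_interval (t : R) : 0 < t < T -> \forall s \near t, 0 < s < T.
Proof.
move=> tT; have tin : t \in `]0, T[ by rewrite in_itv.
by have := near_in_itvoo tin; apply: filterS => s; rewrite in_itv.
Qed.

(** The difference quotients of u converge in L^2, hence weakly: testing against w
    brings the Caputo derivative down to real functions of time. *)
Lemma is_derive_ip (w : X -> R) t : in_Lp 2 Om w -> 0 < t < T ->
  is_derive t 1 (fun tau => ip Om (u tau) w) (ip Om (partial_t u t) w).
Proof.
move=> wL tT; have [_ /(_ _ tT)[dL dcv] _ _] := u_reg.
have utL : in_Lp 2 Om (u t) by apply: u_L2; case/andP: tT => h1 h2; rewrite !ltW.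
have nb : \forall h \near (0 : R)^', in_Lp 2 Om (u (t + h)).
  apply: nbhs_dnbhs; have := near_in_interval tT.
  rewrite (near_shift 0)/= subr0; apply: filterS => h /=.
  by rewrite addrC => /andP[h1 h2]; apply: u_L2; rewrite !ltW.
have cv : (fun h : R => h^-1 *: (((fun tau => ip Om (u tau) w) \o shift t) (h *: 1) -
    ip Om (u t) w)) @ 0^' --> ip Om (partial_t u t) w.
  have c1 : ip Om (fun x => h^-1 * (u (t + h) x - u t x)) w @[h --> 0^'] -->
      ip Om (partial_t u t) w.
    apply: ip_cvg => //; apply: filterS nb => h hL.
    by apply: in_L2Z => //; exact: in_L2B.
  apply: cvg_trans c1; apply: near_eq_cvg; apply: filterS nb => h hL.
  rewrite ipZl//; last exact: in_L2B.
  by rewrite ipBl// /= /GRing.scale/= mulr1 [h + t]addrC.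
split; first by apply/cvg_ex; eexists; exact: cv.
exact: cvg_lim cv.
Qed.

Lemma partial_t_cvg (s : R) : 0 < s < T ->
  normL2 Om (fun x => partial_t u t x - partial_t u s x) @[t --> s] --> 0.
Proof.
move=> sT; have [_ _ c _] := u_reg; apply: normL2_cvg0.
have sI : `]0, T[%classic s by rewrite /= in_itv.
move=> A /(c s sI) h.
have h' : \forall t \near s, `]0, T[%classic t ->
  A (\int[dx]_(x in Om) `|partial_t u t x - partial_t u s x| ^+ 2) by exact: h.
have : \forall t \near s,
  A (\int[dx]_(x in Om) `|partial_t u t x - partial_t u s x| ^+ 2); last by [].
apply: filterS2 (near_in_interval sT) h' => t tT; apply.
by rewrite /= in_itv.
Qed.

Lemma continuous_ip_partial_t (w : X -> R) (s : R) : in_Lp 2 Om w -> 0 < s < T ->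
  {for s, continuous (fun t => ip Om (partial_t u t) w)}.
Proof.
move=> wL sT; apply: ip_cvg => //; first exact: partial_t_L2.
- by have := near_in_interval sT; apply: filterS => t; exact: partial_t_L2.
- exact: partial_t_cvg.
Qed.

Lemma u_cvg (s : R) : 0 <= s <= T ->
  normL2 Om (fun x => u t x - u s x) @[t --> within `[0, T] (nbhs s)] --> 0.
Proof. by move=> sT; apply: normL2_cvg0; apply: u_cont; rewrite /= in_itv. Qed.

Lemma within_continuous_ip (w : X -> R) : in_Lp 2 Om w ->
  {within `[0, T], continuous (fun t => ip Om (u t) w)}.
Proof.
move=> wL; apply/subspace_continuousP => s /=; rewrite in_itv/= => sT.
apply: ip_cvg => //; [exact: u_L2| |exact: u_cvg].
exact: near_within_itv.
Qed.

Lemma normL2_partial_t_cvg (s : R) : 0 < s < T ->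
  normL2 Om (partial_t u t) @[t --> s] --> normL2 Om (partial_t u s).
Proof.
move=> sT; apply/cvgrPdist_le => /= e e0.
have := partial_t_cvg sT => /cvgr0Pnorm_le/(_ e e0).
apply: filterS2 (near_in_interval sT) => t tT.
rewrite ger0_norm ?normL2_ge0//; apply: le_trans.
by rewrite normL2_subC; apply: normL2_dist => //; exact: partial_t_L2.
Qed.

Lemma partial_t_bounded (a b : R) : 0 < a -> a <= b -> b < T ->
  exists2 M : R, 0 <= M & forall t, a <= t <= b -> normL2 Om (partial_t u t) <= M.
Proof.
move=> a0 ab bT.
have [|M M0 h] := @bounded_itv R (fun t => normL2 Om (partial_t u t)) a b ab.
  apply/subspace_continuousP => s /=; rewrite in_itv/= => /andP[as_ sb].
  apply: cvg_within_filter; apply: normL2_partial_t_cvg.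
  by rewrite (lt_le_trans a0)// (le_lt_trans sb).
exists M => // t tab; have := h t; rewrite in_itv/= => /(_ tab).
by rewrite ger0_norm// normL2_ge0.
Qed.

(** The mean value theorem is applied to the real function (u(tau), w), with
    w = u(t) - u(s), whose increment from s to t is |w|^2. *)
Lemma u_lipschitz (a b : R) : 0 < a -> a <= b -> b < T ->
  exists2 L : R, 0 <= L & forall s t, a <= s -> s <= t -> t <= b ->
    normL2 Om (fun x => u t x - u s x) <= L * (t - s).
Proof.
move=> a0 ab bT; have [M M0 hM] := partial_t_bounded a0 ab bT.
exists M => // s t as_ st tb.
have s0 : 0 < s by exact: lt_le_trans as_.
have tT : t < T by exact: le_lt_trans bT.
have inT (x : R) : s <= x <= t -> 0 < x < T.
  by move=> /andP[h1 h2]; rewrite (lt_le_trans s0)//= (le_lt_trans h2).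
have sL : in_Lp 2 Om (u s) by apply: u_L2; rewrite (ltW s0)/= (le_trans st)// ltW.
have tL : in_Lp 2 Om (u t).
  by apply: u_L2; rewrite (ltW tT) andbT (le_trans (ltW s0)).
pose w x := u t x - u s x.
have wL : in_Lp 2 Om w by exact: in_L2B.
have [||c cst_ eqc] := @MVT_segment R (fun tau => ip Om (u tau) w)
   (fun tau => ip Om (partial_t u tau) w) s t st.
- move=> x; rewrite in_itv/= => /andP[h1 h2]; apply: is_derive_ip => //.
  by apply: inT; rewrite !ltW.
- apply: (@continuous_subspaceW _ _ `[s, t]%classic `[0, T]%classic); last exact: within_continuous_ip.
  by apply: subset_itvScc; rewrite bnd_simp ltW.
move: cst_; rewrite in_itv/= => cst_.
have cT := inT c cst_.
have cab : a <= c <= b.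
  by move: cst_ => /andP[h1 h2]; rewrite (le_trans as_)//= (le_trans h2).
have e : normL2 Om w ^+ 2 = ip Om (partial_t u c) w * (t - s).
  by rewrite -eqc normL2_sqr -ipBl.
have h1 : normL2 Om w ^+ 2 <= M * normL2 Om w * (t - s).
  rewrite e ler_wpM2r ?subr_ge0//; apply: (le_trans (ler_norm _)).
  apply: (le_trans (ip_norm_le mOm (partial_t_L2 cT) wL)).
  by rewrite ler_wpM2r ?normL2_ge0// hM.
have [->|w0] := eqVneq (normL2 Om w) 0; first by rewrite mulr_ge0// subr_ge0.
have {}w0 : 0 < normL2 Om w by rewrite lt_neqAle eq_sym w0 normL2_ge0.
by rewrite -(ler_pM2r w0) -expr2 mulrAC.
Qed.

(** The time derivative is taken pointwise in x, so its joint measurability has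
    to be recovered from that of u, modified to be zero outside ]0, T[ x Om. *)
Lemma measurable_partial_t_uncurry :
  measurable_fun (`]0, T[%classic `*` Om)
    (fun p : measurableTypeR R * X => partial_t u p.1 p.2).
Proof.
pose g (tau : R) : X -> R := (if tau \in `]0, T[ then u tau else cst 0) \_ Om.
have mg tau : measurable_fun setT (g tau).
  apply/measurable_restrict => //; rewrite setTI; case: ifPn => [tT|_]; last by [].
  have [] : in_Lp 2 Om (u tau); last by [].
  by apply: u_L2; move: tT; rewrite in_itv/= => /andP[h1 h2]; rewrite !ltW.
have ng (tau : R) x : tau \in `]0, T[ ->
    \forall r \near tau, (if x \in Om then u r x else 0) = g r x.
  by move=> /near_in_itvoo; apply: filterS => r rT; rewrite /g patchE rT.
have dg x tau : tau \in `]0, T[ -> derivable (g ^~ x) tau 1.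
  move=> tT; apply: near_eq_derivable (ng tau x tT) _.
  case: (boolP (x \in Om)) => [/set_mem Ox|_]; last exact: derivable_cst.
  have [du _ _ _] := u_reg; apply: (du x Ox).
  by move: tT; rewrite in_itv.
have h : measurable_fun (`]0, T[%classic `*` Om)
   (fun p : measurableTypeR R * X => derive1 (g ^~ p.2) p.1).
  apply: measurable_funS (measurable_derive1_uncurry mg dg); first exact: measurableX.
  by move=> [tau x] [].
apply: eq_measurable_fun h => -[tau x]; rewrite inE => -[/= tT Ox].
rewrite /partial_t !derive1E; apply/esym; apply: near_eq_derive.
by have := ng tau x tT; rewrite mem_set.
Qed.

(** The speed is integrable but maybe unbounded near 0, where the kernel is
    bounded; near t it is the other way round. *)
Lemma integrable_speed_kernel (al t : R) : 0 < al < 1 -> 0 < t < T ->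
  mu.-integrable `]0, t[
    (EFin \o (fun tau => normL2 Om (partial_t u tau) / (t - tau) `^ al)).
Proof.
move=> al01 /andP[t0 tT]; have /andP[al0 al1] := al01.
have t20 : 0 < t / 2 by rewrite divr_gt0.
have t2t : t / 2 <= t by lra.
have t2E : t - t / 2 = t / 2 by rewrite {1}[t]splitr addrK.
have [M M0 hM] := partial_t_bounded t20 t2t tT.
have [_ _ _ iu] := u_reg.
have iu' : mu.-integrable `]0, t[ (EFin \o (fun tau => normL2 Om (partial_t u tau))).
  apply: integrableS iu => //; apply: subset_itvl; rewrite bnd_simp; exact: ltW.
have ik : mu.-integrable `]0, t[ (EFin \o (fun tau => (t - tau) `^ (- al))).
  apply: integrableS (integrable_kernel al01 t0) => //.
  exact: subset_itv_oo_cc.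
apply: (@integrable_le_EFin _ _ _ mu _ (measurable_itv `]0, t[) _
   (fun tau => (t / 2) `^ (- al) * normL2 Om (partial_t u tau) + M * (t - tau) `^ (- al))).
- apply: measurable_funM.
    by apply/measurable_EFinP; exact: (measurable_int mu iu').
  rewrite (_ : (fun x : R => _) = fun x : R => (t - x) `^ (- al)); last first.
    by apply/funext => x; rewrite powRN.
  by apply/measurable_EFinP; exact: (measurable_int mu ik).
- move=> x /=; rewrite in_itv/= => /andP[x0 xt].
  have nn := normL2_ge0 Om (partial_t u x).
  rewrite ger0_norm ?divr_ge0 ?powR_ge0// -powRN.
  have [xt2|xt2] := leP x (t / 2).
    rewrite -[leLHS]addr0 lerD ?mulr_ge0 ?powR_ge0// mulrC ler_wpM2r// !powRN.
    have tx : t / 2 <= t - x by rewrite -t2E lerB.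
    rewrite lef_pV2 ?posrE ?powR_gt0 ?subr_gt0//.
    by rewrite ge0_ler_powR ?nnegrE ?(ltW al0) ?(ltW t20) ?subr_ge0 ?(ltW xt).
  rewrite -[leLHS]add0r lerD ?mulr_ge0 ?powR_ge0// ler_wpM2r ?powR_ge0//.
  by apply: hM; rewrite !ltW.
- apply: (@integrableD_EFin _ _ _ mu) => //.
    by apply: (@integrableZ_EFin _ _ _ mu).
  by apply: (@integrableZ_EFin _ _ _ mu).
Qed.

(** The equation gives the Caputo derivative at almost every x; multiplying by w
    and integrating, the two integrals are exchanged. *)
Lemma ip_caputo (al t : R) (v w : X -> R) : 0 < al < 1 -> 0 < t < T ->
  in_Lp 2 Om v -> in_Lp 2 Om w ->
  {ae dx, forall x, Om x -> caputo al (fun r => u r x) t = v x} ->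
  mu.-integrable `]0, t[
    (EFin \o (fun tau => ip Om (partial_t u tau) w / (t - tau) `^ al)) /\
  ip Om v w = (Gamma (1 - al))^-1 *
    \int[mu]_(tau in `]0, t[) (ip Om (partial_t u tau) w / (t - tau) `^ al).
Proof.
move=> al01 tT vL wL ae_v; have /andP[t0 t1] := tT.
pose A : set (measurableTypeR R) := `]0, t[%classic.
have mA : measurable A by exact: measurable_itv.
have AT tau : A tau -> 0 < tau < T.
  by rewrite /A/= in_itv/= => /andP[-> h]/=; exact: lt_trans h t1.
have mAO : measurable (A `*` Om : set (measurableTypeR R * X)) by exact: measurableX.
pose F (tau : R) (x : X) := partial_t u tau x * w x / (t - tau) `^ al.
have mF : measurable_fun (A `*` Om) (fun p : measurableTypeR R * X => F p.1 p.2).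
  apply: measurable_funM; first apply: measurable_funM.
  - apply: measurable_funS measurable_partial_t_uncurry; first exact: measurableX.
    by move=> [tau x] [/= /AT h Ox]; split => //=; rewrite in_itv.
  - have mw : measurable_fun Om w by case: wL.
    have : measurable_fun (setT `*` Om : set (measurableTypeR R * X)) (fun p => w p.2).
      move=> _ B mB; have -> : (setT `*` Om) `&` (fun p : measurableTypeR R * X => w p.2) @^-1` B
          = setT `*` (Om `&` w @^-1` B).
        by apply/seteqP; split => [[a b] [[_ /= h1] h2]|[a b] [_ [h1 h2]]].
      by apply: measurableX => //; exact: mw.
    by apply: measurable_funS => [|[a b] [_]]; [exact: measurableX|].
  - rewrite (_ : (fun p : measurableTypeR R * X => _) =
       (fun r : R => (t - r) `^ (- al)) \o fst); last first.
      by apply/funext => p; rewrite /= powRN.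
    apply: measurable_funTS; apply: measurableT_comp; last exact: measurable_fst.
    apply: (measurableT_comp (measurable_powR _)).
    by apply: measurable_funB => //; exact: measurable_id.
have utL tau : A tau -> in_Lp 2 Om (partial_t u tau) by move=> /AT; exact: partial_t_L2.
have iuw tau : A tau -> dx.-integrable Om (EFin \o (fun x => partial_t u tau x * w x)).
  by move=> /utL h; exact: in_L2_mul.
have FE tau : F tau = fun x => ((t - tau) `^ al)^-1 * (partial_t u tau x * w x).
  by apply/funext => x; rewrite /F mulrC.
have iF tau : A tau -> dx.-integrable Om (EFin \o F tau).
  by move=> At; rewrite FE; apply: integrableZ_EFin => //; exact: iuw.
pose N (tau : R) := normL2 Om w * (normL2 Om (partial_t u tau) / (t - tau) `^ al).
have in_L2_norm f : in_Lp 2 Om f -> in_Lp 2 Om (fun x => `|f x|).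
  move=> [mf fi]; split; first exact: measurableT_comp.
  by apply: eq_integrable fi => // x _ /=; rewrite normr_id.
have normL2_norm f : normL2 Om (fun x => `|f x|) = normL2 Om f.
  by congr Num.sqrt; apply: eq_Rintegral => x _; rewrite real_normK ?num_real.
have FN tau : A tau -> \int[dx]_(x in Om) `|F tau x| <= N tau.
  move=> At; have L1 := in_L2_norm _ (utL tau At); have L2 := in_L2_norm _ wL.
  have -> : \int[dx]_(x in Om) `|F tau x| =
      ((t - tau) `^ al)^-1 * ip Om (fun x => `|partial_t u tau x|) (fun x => `|w x|).
    rewrite -RintegralZl//; last exact: in_L2_mul.
    apply: eq_Rintegral => x _; rewrite FE !normrM [X in X * _]ger0_norm//.
    by rewrite invr_ge0 powR_ge0.
  have -> : N tau = ((t - tau) `^ al)^-1 * (normL2 Om (partial_t u tau) * normL2 Om w).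
    by rewrite /N; ring.
  rewrite ler_wpM2l ?invr_ge0 ?powR_ge0//.
  have := ip_norm_le mOm L1 L2; rewrite !normL2_norm; apply: le_trans.
  exact: ler_norm.
have iN : mu.-integrable A (EFin \o N).
  by apply: (@integrableZ_EFin _ _ _ mu) => //; exact: integrable_speed_kernel.
have h1 := integrable_Rintegral_param mA mOm mF iF FN iN.
have h2 := ae_integrable_param mA mOm mF iF FN iN.
have h3 := measurable_Rintegral_param mA mOm mF iF FN iN.
have h4 := Rintegral_swap mA mOm mF iF FN iN.
have FI tau : A tau -> \int[dx]_(x in Om) F tau x = ip Om (partial_t u tau) w / (t - tau) `^ al.
  by move=> At; rewrite FE RintegralZl//; [rewrite mulrC|exact: iuw].
split.
  by apply: eq_integrable h1 => // tau /set_mem At /=; rewrite FI.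
have -> : \int[mu]_(tau in `]0, t[) (ip Om (partial_t u tau) w / (t - tau) `^ al) =
    \int[mu]_(tau in A) \int[dx]_(x in Om) F tau x.
  by apply: eq_Rintegral => tau /set_mem At; rewrite FI.
rewrite h4; set c := (Gamma (1 - al))^-1.
have iswap := integrable_Rintegral_param_swap mA mOm mF iF FN iN.
rewrite -RintegralZl// /ip /Rintegral; congr fine.
apply: ae_eq_integral => //.
- by apply/measurable_EFinP; apply: measurable_funM; [case: vL|case: wL].
- by apply/measurable_EFinP; apply: measurable_funM.
apply: filterS2 ae_v h2 => x hv hi Ox; rewrite -(hv Ox) /caputo -/c; congr EFin.
rewrite -mulrA; congr (c * _).
(* integrability in time at x is known after multiplication by w x only *)
have [w0|w0] := eqVneq (w x) 0.
  rewrite w0 mulr0 /Rintegral integral0_eq// => tau _.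
  by rewrite /F w0 mulr0 mul0r.
rewrite -RintegralZr//.
  by apply: eq_Rintegral => tau _; rewrite /F /partial_t mulrAC.
have := @integrableZ_EFin _ _ _ mu _ mA (w x)^-1 _ (hi Ox).
apply: eq_integrable => // tau _ /=; rewrite /F /partial_t; congr EFin.
by rewrite [_ * w x]mulrC -mulrA mulrA mulVf// mul1r.
Qed.

Lemma ip_caputo_by_parts (al t : R) (v w : X -> R) : 0 < al < 1 -> 0 < t < T ->
  in_Lp 2 Om v -> in_Lp 2 Om w ->
  {ae dx, forall x, Om x -> caputo al (fun r => u r x) t = v x} ->
  mu.-integrable `[0, t]
    (EFin \o (fun tau => ip Om (fun x => u t x - u tau x) w / (t - tau) `^ (al + 1))) /\
  ip Om v w = (Gamma (1 - al))^-1 *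
    (ip Om (fun x => u t x - u 0 x) w / t `^ al +
     al * \int[mu]_(tau in `[0, t])
       (ip Om (fun x => u t x - u tau x) w / (t - tau) `^ (al + 1))).
Proof.
move=> al01 tT vL wL ae_v; have /andP[t0 t1] := tT.
have [ik ->] := ip_caputo al01 tT vL wL ae_v.
have inT tau : tau \in `[0, t] -> 0 <= tau <= T.
  by rewrite in_itv/= => /andP[-> h]/=; rewrite (le_trans h)// ltW.
have utL : in_Lp 2 Om (u t) by apply: u_L2; rewrite !ltW.
pose phi tau := ip Om (u tau) w.
have phiB tau : tau \in `[0, t] -> phi t - phi tau = ip Om (fun x => u t x - u tau x) w.
  by move=> /inT h; rewrite /phi ipBl//; exact: u_L2.
have t20 : 0 < t / 2 by rewrite divr_gt0.
have t2t : t / 2 < t by lra.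
have [L L0 hL] := u_lipschitz t20 (ltW t2t) t1.
have cphi : {within `[0, t], continuous phi}.
  apply: (@continuous_subspaceW _ _ `[0, t]%classic `[0, T]%classic).
    by apply: subset_itvl; rewrite bnd_simp ltW.
  exact: within_continuous_ip.
have oT x : x \in `]0, t[ -> 0 < x < T.
  by rewrite in_itv/= => /andP[-> h]/=; exact: lt_trans t1.
have L'0 : 0 <= L * normL2 Om w by rewrite mulr_ge0// normL2_ge0.
have phiL tau : t / 2 <= tau <= t -> `|phi t - phi tau| <= L * normL2 Om w * (t - tau).
  move=> /andP[h1 h2]; have tin : tau \in `[0, t] by rewrite in_itv/= h2 (le_trans (ltW t20)).
  rewrite phiB//; have bL : in_Lp 2 Om (fun x => u t x - u tau x).
    by apply: in_L2B => //; apply: u_L2; exact: inT.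
  apply: (le_trans (ip_norm_le mOm bL wL)).
  by rewrite mulrAC ler_wpM2r ?normL2_ge0// hL.
have dphi x : x \in `]0, t[ -> is_derive x 1 phi (ip Om (partial_t u x) w).
  by move=> /oT h; exact: is_derive_ip.
have cdphi : {in `]0, t[, continuous (fun tau => ip Om (partial_t u tau) w)}.
  by move=> x /oT h; exact: continuous_ip_partial_t.
have [ig ->] := Rintegral_fractional_by_parts al01 (ltW t20) t2t L'0 cphi dphi cdphi ik phiL.
split.
  apply: eq_integrable ig => // tau; rewrite inE => tin /=.
  by rewrite phiB.
congr (_ * (_ / _ + _ * _)).
  by rewrite phiB// in_itv/= lexx ltW.
by apply: eq_Rintegral => tau; rewrite inE => tin; rewrite phiB.
Qed.

End time_regularity.

(** * One-step estimate of the Ginzburg-Landau energy *)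
Section energy.
Context {R : realType} {n : nat}.
Local Notation X := 'rV[R]_n.+1.
Local Notation dx := (@lebesgue_rV R n.+1).
Variables (Om : set X).
Hypotheses (mOm : measurable Om) (bOm : bounded_set Om).

Lemma derive1_double_well (s : R) : derive1 (@double_well R) s = s ^+ 3 - s.
Proof.
rewrite derive1E.
have h : is_derive s 1 (fun x : R => x ^+ 2 - 1) (2 * s).
  have := is_deriveB (is_deriveX 2 (is_derive_id s (1 : R))) (is_derive_cst (1 : R) s (1 : R)).
  have -> // : (2%:R * s ^+ 2.-1) *: (1 : R) - 0 = 2 * s :> R.
  by rewrite subr0 /GRing.scale/= mulr1 expr1.
have := is_deriveZ (4^-1 : R) (is_deriveX 2 h).
have -> : 4^-1 *: ((2%:R * (s ^+ 2 - 1) ^+ 2.-1) *: (2 * s)) = s ^+ 3 - s :> R.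
  by rewrite /GRing.scale/= expr1; field.
by case.
Qed.

(** F'' >= -1, so that F(s) + s^2 / 2 is convex. The gap is explicit: it is
    ((c^2 - a^2)^2 + 2 a^2 (c - a)^2) / 4. *)
Lemma double_well_le (a c : R) :
  double_well a - double_well c <= (a ^+ 3 - a) * (a - c) + (a - c) ^+ 2 / 2.
Proof.
rewrite /double_well -subr_ge0.
have -> : (a ^+ 3 - a) * (a - c) + (a - c) ^+ 2 / 2 -
    (4^-1 * (a ^+ 2 - 1) ^+ 2 - 4^-1 * (c ^+ 2 - 1) ^+ 2) =
    4^-1 * ((c ^+ 2 - a ^+ 2) ^+ 2 + 2 * a ^+ 2 * (c - a) ^+ 2) by field.
apply: mulr_ge0 => //; apply: addr_ge0; first exact: sqr_ge0.
by apply: mulr_ge0; [apply: mulr_ge0 => //|]; exact: sqr_ge0.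
Qed.

Lemma in_L4_sqr (f : X -> R) : in_Lp 4 Om f -> in_Lp 2 Om (fun x => f x ^+ 2).
Proof.
move=> [mf fi]; split; first exact: measurable_funX.
by apply: eq_integrable fi => // x _ /=; rewrite normrX -exprM.
Qed.

Lemma in_L4_intro (f : X -> R) : measurable_fun Om f ->
  in_Lp 2 Om (fun x => f x ^+ 2) -> in_Lp 4 Om f.
Proof.
move=> mf [_ fi]; split => //.
by apply: eq_integrable fi => // x _ /=; rewrite normrX -exprM.
Qed.

Lemma in_L4_mul (f g : X -> R) : in_Lp 4 Om f -> in_Lp 4 Om g ->
  in_Lp 2 Om (fun x => f x * g x).
Proof.
move=> fL gL; have [mf _] := fL; have [mg _] := gL.
apply: in_L2_intro => //; first exact: measurable_funM.
have := in_L2_mul mOm (in_L4_sqr fL) (in_L4_sqr gL).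
by apply: eq_integrable => // x _ /=; rewrite exprMn.
Qed.

Lemma in_L4B (f g : X -> R) : in_Lp 4 Om f -> in_Lp 4 Om g ->
  in_Lp 4 Om (fun x => f x - g x).
Proof.
move=> fL gL; have [mf _] := fL; have [mg _] := gL.
apply: in_L4_intro; first exact: measurable_funB.
have h1 := in_L2_lin mOm 1 (- 2) (in_L4_sqr fL) (in_L4_mul fL gL).
apply: eq_in_Lp (in_L2D mOm h1 (in_L4_sqr gL)) => // x _.
by rewrite sqrrB -mulr_natl; ring.
Qed.

Lemma integrable_double_well (f : X -> R) : in_Lp 2 Om f -> in_Lp 4 Om f ->
  dx.-integrable Om (EFin \o (fun x => double_well (f x))).
Proof.
move=> f2 f4; have i4 := in_L2_sqr mOm (in_L4_sqr f4); have i2 := in_L2_sqr mOm f2.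
have i0 : dx.-integrable Om (EFin \o (fun=> 4^-1 : R)).
  apply: measurable_bounded_integrable => //; first exact: lebesgue_rV_bounded.
  exists `|4^-1|; split => // y hy x _ /=; exact: ltW.
have h := integrableD_EFin mOm (integrableB_EFin mOm
  (integrableZ_EFin mOm (4^-1) i4) (integrableZ_EFin mOm (2^-1) i2)) i0.
apply: eq_integrable h => // x _ /=; congr EFin.
by rewrite /double_well; field.
Qed.

Variables (eps : R) (u : R -> X -> R) (Gu : R -> X -> X).

Lemma energyE t : in_Lp 2 Om (u t) -> in_Lp 4 Om (u t) -> in_vL2 Om (Gu t) ->
  energy Om eps u Gu t = eps ^+ 2 / 2 * vip Om (Gu t) (Gu t) +
    \int[dx]_(x in Om) double_well (u t x).
Proof.
move=> u2 u4 GL; rewrite -sqnormL2E// /energy /sqnormL2.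
have iG : dx.-integrable Om (EFin \o (fun x => \sum_i Gu t x ord0 i ^+ 2)).
  have := @integrable_sum _ _ _ dx _ mOm _ (index_enum _) predT
    (fun i => EFin \o (fun x => Gu t x ord0 i ^+ 2)) (fun i _ => in_L2_sqr mOm (GL i)).
  by apply: eq_integrable => // x _ /=; rewrite sumEFin.
rewrite RintegralD//; last 2 first.
- exact: integrableZ_EFin.
- exact: integrable_double_well.
by rewrite RintegralZl.
Qed.

(** The terms in Gu and u are what (m(t), u(t) - u(s)) becomes after an integration
    by parts in space. The cubic term is paired as u^2 times u (u(t) - u(s)), each
    factor being in L^2 because u is in L^4. Stated without the
    equation, the estimate holds at t = T as well. *)
Lemma energy_increment_le t s :
  in_Lp 2 Om (u t) -> in_Lp 4 Om (u t) -> in_vL2 Om (Gu t) ->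
  in_Lp 2 Om (u s) -> in_Lp 4 Om (u s) -> in_vL2 Om (Gu s) ->
  energy Om eps u Gu t - energy Om eps u Gu s <=
  eps ^+ 2 * (vip Om (Gu t) (Gu t) - vip Om (Gu t) (Gu s)) +
  (ip Om (fun x => u t x ^+ 2) (fun x => u t x * (u t x - u s x)) -
   ip Om (u t) (fun x => u t x - u s x)) +
  ip Om (fun x => u t x - u s x) (fun x => u t x - u s x) / 2.
Proof.
move=> t2 t4 tG s2 s4 sG; rewrite !energyE//.
have bL : in_Lp 2 Om (fun x => u t x - u s x) by exact: in_L2B.
have bL4 : in_Lp 4 Om (fun x => u t x - u s x) by exact: in_L4B.
have Wt := integrable_double_well t2 t4; have Ws := integrable_double_well s2 s4.
have I1 := in_L2_mul mOm (in_L4_sqr t4) (in_L4_mul t4 bL4).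
have I2 := in_L2_mul mOm t2 bL.
have I3 := in_L2_mul mOm bL bL.
have W : \int[dx]_(x in Om) double_well (u t x) - \int[dx]_(x in Om) double_well (u s x) <=
  (ip Om (fun x => u t x ^+ 2) (fun x => u t x * (u t x - u s x)) -
   ip Om (u t) (fun x => u t x - u s x)) +
  2^-1 * ip Om (fun x => u t x - u s x) (fun x => u t x - u s x).
  have I4 := integrableB_EFin mOm I1 I2.
  have I5 := integrableZ_EFin mOm 2^-1 I3.
  rewrite /ip -RintegralZl// -RintegralB// -RintegralB// -RintegralD//.
  apply: le_Rintegral => //.
  - exact: integrableB_EFin.
  - exact: integrableD_EFin.
  move=> x _; apply: (le_trans (double_well_le _ _)).
  by rewrite le_eqVlt; apply/orP; left; apply/eqP; field.
have V : vip Om (Gu t) (Gu t) / 2 - vip Om (Gu s) (Gu s) / 2 <=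
    vip Om (Gu t) (Gu t) - vip Om (Gu t) (Gu s).
  have dG : in_vL2 Om (fun x => Gu t x - Gu s x) by exact: in_vL2B.
  have := vip_ge0 Om (fun x => Gu t x - Gu s x).
  rewrite vipBl// ![vip Om _ (fun x => _ - _)]vipC !vipBl// (vipC Om (Gu s) (Gu t)).
  by lra.
have V' := ler_wpM2l (sqr_ge0 eps) V.
move: W V'; set A := \int[dx]_(x in Om) double_well (u t x).
set B := \int[dx]_(x in Om) double_well (u s x).
set c := eps ^+ 2; set v1 := vip _ _ _; set v2 := vip _ _ _; set v3 := vip _ _ _.
set i1 := ip _ _ _; set i2 := ip _ _ _; set i3 := ip _ _ _.
clearbody A B c v1 v2 v3 i1 i2 i3; rewrite !mulrBr.
clear -A; lra.
Qed.

End energy.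

(** * Dissipation for the time-fractional Cahn-Hilliard equation *)
Section dissipation.
Context {R : realType} {n : nat}.
Local Notation X := 'rV[R]_n.+1.
Local Notation dx := (@lebesgue_rV R n.+1).
Notation mu := (@lebesgue_measure R).
Variables (Om : set X) (T alpha gamma eps : R) (u Psi : R -> X -> R).
Variables (Gu GPsi : R -> X -> X).
Hypotheses (Om_open : open Om) (bOm : bounded_set Om).
Hypotheses (T_gt0 : 0 < T) (alpha01 : 0 < alpha < 1) (gamma_gt0 : 0 < gamma).
Hypothesis u_sol : tfCH_solution Om T alpha gamma eps u Gu.
Hypothesis Psi_sol : inverse_laplacian Om T u Psi GPsi.
Hypothesis D_def : forall t, 0 < t <= T -> memory_well_defined Om alpha GPsi t.

Let mOm : measurable Om. Proof. exact: open_measurable_rV. Qed.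

Let u_L2 (t : R) : 0 <= t <= T -> in_Lp 2 Om (u t).
Proof. by move=> /(tfCH_dirichlet u_sol) [[]]. Qed.

Let Gu_L2 (t : R) : 0 <= t <= T -> in_vL2 Om (Gu t).
Proof. by move=> /(tfCH_dirichlet u_sol) [[]]. Qed.

Let u_L4 (t : R) : 0 <= t <= T -> in_Lp 4 Om (u t).
Proof. exact: tfCH_L4 u_sol t. Qed.

Let GPsi_L2 (t : R) : 0 <= t <= T -> in_vL2 Om (GPsi t).
Proof. by move=> /(ilap_dirichlet Psi_sol) [[]]. Qed.

Let u_cont : continuous_Lp 2 Om `[0, T] u.
Proof. by have [] := tfCH_continuous u_sol. Qed.

Let T0 : 0 <= (0 : R) <= T. Proof. by rewrite lexx ltW. Qed.
Let TT : 0 <= T <= T. Proof. by rewrite lexx ltW. Qed.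

Definition potential_dist t s : R :=
  vip Om (fun x => GPsi t x - GPsi s x) (fun x => GPsi t x - GPsi s x).

Definition solution_dist t s : R :=
  ip Om (fun x => u t x - u s x) (fun x => u t x - u s x).

Local Notation N := potential_dist.
Local Notation N2 := solution_dist.

(** Psi(t) represents the functional v |-> (u(t) - u(0), v) in the inner product of
    gradients. *)
Lemma vip_potential t v Gv : 0 <= t <= T -> in_H10 Om v Gv ->
  vip Om (GPsi t) Gv = ip Om (fun x => u t x - u 0 x) v.
Proof.
move=> tT vH; have [LPsi lP ae_u] := ilap_equation Psi_sol tT.
have [gP _] := ilap_dirichlet Psi_sol tT.
have [_ [mL _] _] := lP; have [[[mv _] _ _] _] := vH.
have [mut _] := u_L2 tT; have [mu0 _] := u_L2 T0.
rewrite (green mOm bOm vH gP lP) /ip -mulN1r.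
have iL : dx.-integrable Om (EFin \o (fun x => LPsi x * v x)).
  by have [_ L2 _] := lP; have [[vL _ _] _] := vH; exact: in_L2_mul.
rewrite -RintegralZl//; congr fine; apply: ae_eq_integral => //.
- by apply/measurable_EFinP; do 2 apply: measurable_funM => //.
- by apply/measurable_EFinP; apply: measurable_funM => //; exact: measurable_funB.
by apply: filterS ae_u => x h Ox; rewrite -(h Ox) mulN1r mulNr.
Qed.

Lemma vip_potentialB t s v Gv : 0 <= t <= T -> 0 <= s <= T -> in_H10 Om v Gv ->
  vip Om (fun x => GPsi t x - GPsi s x) Gv = ip Om (fun x => u t x - u s x) v.
Proof.
move=> tT sT vH; have [[vL GvL _] _] := vH.
rewrite vipBl//; [|exact: GPsi_L2..]; rewrite !(vip_potential _ vH)//.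
by rewrite !ipBl//; [ring|exact: u_L2..].
Qed.

Lemma potentialB_H10 t s : 0 <= t <= T -> 0 <= s <= T ->
  in_H10 Om (fun x => Psi t x - Psi s x) (fun x => GPsi t x - GPsi s x).
Proof. by move=> tT sT; apply: in_H10B => //; exact: (ilap_dirichlet Psi_sol). Qed.

Lemma potential_dist_polar t tau s : 0 <= t <= T -> 0 <= tau <= T -> 0 <= s <= T ->
  polar N t tau s = vip Om (fun x => GPsi t x - GPsi tau x) (fun x => GPsi t x - GPsi s x).
Proof.
move=> tT tauT sT; rewrite /polar /N.
have h1 := GPsi_L2 tT; have h2 := GPsi_L2 tauT; have h3 := GPsi_L2 sT.
have d1 := in_vL2B mOm h1 h2; have d2 := in_vL2B mOm h1 h3; have d3 := in_vL2B mOm h2 h3.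
rewrite !(vipBl mOm)// !(vipC Om _ (fun x => _ - _)) !(vipBl mOm)//.
rewrite (vipC Om (GPsi tau) (GPsi t)) (vipC Om (GPsi s) (GPsi t)) (vipC Om (GPsi s) (GPsi tau)).
by field.
Qed.

Lemma polar_ip t tau s : 0 <= t <= T -> 0 <= tau <= T -> 0 <= s <= T ->
  polar N t tau s = ip Om (fun x => u t x - u tau x) (fun x => Psi t x - Psi s x).
Proof.
move=> tT tauT sT; rewrite potential_dist_polar//.
by apply: vip_potentialB => //; exact: potentialB_H10.
Qed.

Lemma potential_dist_CS t tau s : 0 <= t <= T -> 0 <= tau <= T -> 0 <= s <= T ->
  polar N t tau s ^+ 2 <= N t tau * N t s.
Proof.
move=> tT tauT sT; rewrite potential_dist_polar//.
by apply: vip_CS => //; apply: in_vL2B => //; exact: GPsi_L2.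
Qed.

(** |grad psi|^2 = (u(t) - u(s), psi) for psi = Psi(t) - Psi(s), and the Poincare
    inequality bounds |psi| by |grad psi|. *)
Lemma potential_dist_le : exists2 C : R, 0 <= C &
  forall t s, 0 <= t <= T -> 0 <= s <= T -> N t s <= C * N2 t s.
Proof.
have [C C0 hC] := poincare mOm bOm; exists C => // t s tT sT.
have H := potentialB_H10 tT sT; have h := hC _ _ H; rewrite -/(N t s) in h.
have [[vL _ _] _] := H.
have e : N t s = ip Om (fun x => u t x - u s x) (fun x => Psi t x - Psi s x).
  exact: vip_potentialB.
have bL : in_Lp 2 Om (fun x => u t x - u s x) by apply: in_L2B => //; exact: u_L2.
have cs := ip_CS mOm bL vL; rewrite -e -/(N2 t s) in cs.
have N0 : 0 <= N t s := vip_ge0 _ _.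
have N20 : 0 <= N2 t s := ip_ge0 _ _.
have [->|Nn0] := eqVneq (N t s) 0; first by rewrite mulr_ge0.
have Np : 0 < N t s by rewrite lt_neqAle eq_sym Nn0.
rewrite -(ler_pM2r Np) -expr2 (le_trans cs)//.
by rewrite mulrC [leRHS]mulrAC ler_wpM2r.
Qed.

Lemma solution_dist_lip a b : 0 < a -> a <= b -> b < T -> exists2 L, 0 <= L &
  forall s t : R, a <= s -> s <= t -> t <= b -> N2 t s <= L * (t - s) ^+ 2.
Proof.
move=> a0 ab bT.
have [L L0 hL] := u_lipschitz mOm u_L2 u_cont (tfCH_time_regular u_sol) a0 ab bT.
exists (L ^+ 2) => [|s t as_ st tb]; first exact: sqr_ge0.
rewrite -exprMn /N2 -normL2_sqr ler_pXn2r ?nnegrE ?normL2_ge0 ?hL//.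
by rewrite mulr_ge0// subr_ge0.
Qed.

Lemma solution_dist_cvg s : 0 <= s <= T ->
  N2 t s @[t --> within `[0, T] (nbhs s)] --> 0.
Proof.
move=> sT; have := @u_cont s; rewrite /= in_itv/= => /(_ sT).
by under eq_fun do rewrite ip_normr2.
Qed.

Lemma integrable_potential_dist t : 0 < t <= T -> mu.-integrable `[0, t]
  (EFin \o (fun tau => N t tau / (t - tau) `^ (alpha + 1))).
Proof.
move=> tT; have := D_def tT; rewrite /memory_well_defined.
apply: eq_integrable => // tau; rewrite inE /= in_itv/= => /andP[h1 h2].
have /andP[t0 t1] := tT.
rewrite /memory_integrand sqnormL2E//.
by apply: in_vL2B => //; apply: GPsi_L2; [rewrite ltW|rewrite h1 (le_trans h2)].
Qed.

(** The step where the equation enters: the pairing of the chemical potential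
    with u(t) - u(s) = - Lap (Psi(t) - Psi(s)) equals minus the pairing of its
    Laplacian with Psi(t) - Psi(s), and that Laplacian is the Caputo derivative
    divided by gamma. *)
Lemma energy_inequality t s : 0 < t < T -> 0 <= s <= T ->
  mu.-integrable `[0, t]
    (EFin \o (fun tau => polar N t tau s / (t - tau) `^ (alpha + 1))) /\
  energy Om eps u Gu t - energy Om eps u Gu s <= N2 t s / 2 -
    (gamma * Gamma (1 - alpha))^-1 * (polar N t 0 s / t `^ alpha +
    alpha * \int[mu]_(tau in `[0, t]) (polar N t tau s / (t - tau) `^ (alpha + 1))).
Proof.
move=> tT sT; have /andP[t0 t1] := tT.
have tT' : 0 <= t <= T by rewrite !ltW.
have [Lu [Gm [Lm [lu Hm lm ae_c]]]] := tfCH_equation u_sol tT.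
set m := chemical_potential eps (u t) Lu in Hm lm.
have [[mL GmL _] _] := Hm; have [_ LmL _] := lm; have [_ LuL _] := lu.
have utL := u_L2 tT'; have usL := u_L2 sT.
have bL : in_Lp 2 Om (fun x => u t x - u s x) by exact: in_L2B.
have [gu _] := tfCH_dirichlet u_sol tT'.
have wH := potentialB_H10 tT' sT; have [[wL _ _] _] := wH.
have polE tau : tau \in `[0, t] ->
    polar N t tau s = ip Om (fun x => u t x - u tau x) (fun x => Psi t x - Psi s x).
  rewrite in_itv/= => /andP[h1 h2]; apply: polar_ip => //.
  by rewrite h1 (le_trans h2)// ltW.
have gLmL := in_L2Z mOm gamma LmL.
have [ik eqc] := ip_caputo_by_parts mOm u_L2 u_cont (tfCH_time_regular u_sol)
   alpha01 tT gLmL wL ae_c.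
split.
  by apply: eq_integrable ik => // tau; rewrite inE => tin /=; rewrite polE.
have -> : (gamma * Gamma (1 - alpha))^-1 * (polar N t 0 s / t `^ alpha +
    alpha * \int[mu]_(tau in `[0, t]) (polar N t tau s / (t - tau) `^ (alpha + 1))) =
    ip Om Lm (fun x => Psi t x - Psi s x).
  have -> : ip Om Lm (fun x => Psi t x - Psi s x) =
      gamma^-1 * ip Om (fun x => gamma * Lm x) (fun x => Psi t x - Psi s x).
    by rewrite ipZl// mulKf// gt_eqF.
  rewrite eqc invfM mulrA; congr (_ * (_ / _ + _ * _)).
    by rewrite polE// in_itv/= lexx ltW.
  by apply: eq_Rintegral => tau; rewrite inE => tin; rewrite polE.
have gm : ip Om Lm (fun x => Psi t x - Psi s x) = - ip Om m (fun x => u t x - u s x).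
  have [gm _] := Hm.
  rewrite -[LHS]opprK -(green mOm bOm wH gm lm) vipC.
  by rewrite (vip_potentialB tT' sT Hm) ipC.
rewrite gm opprK.
have EI := @energy_increment_le R n Om mOm bOm eps u Gu t s utL (u_L4 tT') (Gu_L2 tT')
   usL (u_L4 sT) (Gu_L2 sT).
apply: (le_trans EI).
have e1 : vip Om (Gu t) (Gu t) - vip Om (Gu t) (Gu s) = - ip Om Lu (fun x => u t x - u s x).
  rewrite (green mOm bOm (tfCH_dirichlet u_sol tT') gu lu).
  rewrite (green mOm bOm (tfCH_dirichlet u_sol sT) gu lu).
  by rewrite ipBr//; ring.
have e2 : ip Om m (fun x => u t x - u s x) =
   - eps ^+ 2 * ip Om Lu (fun x => u t x - u s x) +
   (ip Om (fun x => u t x ^+ 2) (fun x => u t x * (u t x - u s x)) -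
    ip Om (u t) (fun x => u t x - u s x)).
  have I1 := in_L2_mul mOm (in_L4_sqr mOm (u_L4 tT')) (in_L4_mul mOm (u_L4 tT') (in_L4B mOm (u_L4 tT') (u_L4 sT))).
  have I2 := in_L2_mul mOm utL bL.
  have I3 := in_L2_mul mOm LuL bL.
  have I4 := integrableB_EFin mOm I1 I2.
  have I5 := integrableZ_EFin mOm (- eps ^+ 2) I3.
  rewrite /ip -RintegralZl// -RintegralB// -RintegralD//.
  apply: eq_Rintegral => x _; rewrite /m /chemical_potential derive1_double_well; ring.
rewrite e1 e2 -/(N2 t s) mulrN mulNr.
by rewrite addrC.
Qed.

(** [energy_increment_le] at time T and t: all terms of the bound are linear or
    quadratic in u(T) - u(t) and tend to 0, the cubic one thanks to the
    continuity of u in L^4. *)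
Lemma energy_lsc : exists2 err : R -> R,
  err t @[t --> within `[0, T] (nbhs T)] --> 0 &
  forall t, 0 <= t <= T -> energy Om eps u Gu T <= energy Om eps u Gu t + err t.
Proof.
pose err t := eps ^+ 2 * (vip Om (Gu T) (Gu T) - vip Om (Gu T) (Gu t)) +
  (ip Om (fun x => u T x ^+ 2) (fun x => u T x * (u T x - u t x)) -
   ip Om (u T) (fun x => u T x - u t x)) + N2 T t / 2.
exists err; last first.
  move=> t tT; rewrite -lerBlDl; apply: energy_increment_le => //;
    [exact: u_L2|exact: u_L4|exact: Gu_L2|exact: u_L2|exact: u_L4|exact: Gu_L2].
have [_ c4 cG] := tfCH_continuous u_sol.
have G_cvg i : ip Om (fun x => Gu t x ord0 i) (fun x => Gu T x ord0 i)
    @[t --> within `[0, T] (nbhs T)] --> ip Om (fun x => Gu T x ord0 i) (fun x => Gu T x ord0 i).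
  apply: ip_cvg => //; [exact: Gu_L2|exact: Gu_L2| |].
    by apply: near_within_itv => t tT; exact: Gu_L2.
  by apply: normL2_cvg0; apply: cG; rewrite /= in_itv.
have V_cvg : vip Om (Gu T) (Gu t) @[t --> within `[0, T] (nbhs T)] --> vip Om (Gu T) (Gu T).
  apply: cvg_sum_seq => i; under eq_fun do rewrite ipC.
  exact: G_cvg.
have bL t : 0 <= t <= T -> in_Lp 4 Om (fun x => u T x - u t x).
  by move=> tT; apply: in_L4B => //; exact: u_L4.
have uT2 := in_L4_sqr mOm (u_L4 TT).
pose q t := normL2 Om (fun x => (u T x - u t x) ^+ 2).
have q_cvg : q t @[t --> within `[0, T] (nbhs T)] --> 0.
  apply: normL2_cvg0; have := c4 T; rewrite /= in_itv/= => /(_ TT).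
  rewrite (_ : (fun t => \int[dx]_(x in Om) `|u t x - u T x| ^+ 4) =
    (fun t => \int[dx]_(x in Om) `|(u T x - u t x) ^+ 2| ^+ 2)) //.
  apply/funext => t; apply: eq_Rintegral => x _.
  by rewrite distrC normrX -exprM.
pose K := normL2 Om (fun x => u T x ^+ 2).
have cubic_le t : 0 <= t <= T ->
    `|ip Om (fun x => u T x ^+ 2) (fun x => u T x * (u T x - u t x))| <= K * Num.sqrt (K * q t).
  move=> tT; have uTb := in_L4_mul mOm (u_L4 TT) (bL t tT).
  apply: (le_trans (ip_norm_le mOm uT2 uTb)); rewrite ler_wpM2l ?normL2_ge0//.
  rewrite normL2E ler_sqrt ?mulr_ge0 ?normL2_ge0//.
  have -> : ip Om (fun x => u T x * (u T x - u t x)) (fun x => u T x * (u T x - u t x)) =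
      ip Om (fun x => u T x ^+ 2) (fun x => (u T x - u t x) ^+ 2).
    by apply: eq_Rintegral => x _; ring.
  exact: le_trans (ler_norm _) (ip_norm_le mOm uT2 (in_L4_sqr mOm (bL t tT))).
have cubic_cvg : ip Om (fun x => u T x ^+ 2) (fun x => u T x * (u T x - u t x))
    @[t --> within `[0, T] (nbhs T)] --> 0.
  have B_cvg : K * Num.sqrt (K * q t) @[t --> within `[0, T] (nbhs T)] --> 0.
    rewrite -[X in _ --> X](mulr0 K); apply: cvgM; first exact: cvg_cst.
    have Kq : K * q t @[t --> within `[0, T] (nbhs T)] --> 0.
      by rewrite -[X in _ --> X](mulr0 K); apply: cvgM; [exact: cvg_cst|exact: q_cvg].
    have := @sqrt_continuous R 0; rewrite /continuous_at sqrtr0 => s0.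
    exact: (cvg_comp _ _ Kq s0).
  apply/cvgr0Pnorm_le => e e0; move/cvgr0Pnorm_le : B_cvg => /(_ e e0).
  apply: filter_app; apply: near_within_itv => t tT; apply: le_trans.
  exact: le_trans (cubic_le t tT) (ler_norm _).
have lin_cvg : ip Om (u T) (fun x => u T x - u t x) @[t --> within `[0, T] (nbhs T)] --> 0.
  apply/cvgr0Pnorm_le => e e0.
  have c : normL2 Om (u T) * normL2 Om (fun x => u t x - u T x)
      @[t --> within `[0, T] (nbhs T)] --> 0.
    rewrite -[X in _ --> X](mulr0 (normL2 Om (u T))); apply: cvgM; first exact: cvg_cst.
    by apply: normL2_cvg0; apply: u_cont; rewrite /= in_itv.
  move/cvgr0Pnorm_le : c => /(_ e e0).
  apply: filter_app; apply: near_within_itv => t tT; apply: le_trans.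
  apply: le_trans (ler_norm _); rewrite [X in _ * X]normL2_subC.
  apply: ip_norm_le => //; first exact: u_L2.
  by apply: in_L2B => //; exact: u_L2.
have quad_cvg : N2 T t @[t --> within `[0, T] (nbhs T)] --> 0.
  rewrite (_ : (fun t => N2 T t) = (fun t => N2 t T)); first exact: solution_dist_cvg.
  by apply/funext => t; apply: eq_Rintegral => x _; ring.
rewrite /err -[X in _ --> X](_ : eps ^+ 2 * (vip Om (Gu T) (Gu T) - vip Om (Gu T) (Gu T)) +
   (0 - 0) + 0 / 2 = 0); last by rewrite subrr mulr0 subr0 mul0r !addr0.
apply: cvgD; last by apply: cvgM => //; exact: cvg_cst.
apply: cvgD; last exact: cvgB.
by apply: cvgM; [exact: cvg_cst|apply: cvgB => //; exact: cvg_cst].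
Qed.

(** The norm of grad Psi(t) is that of grad (Psi(t) - Psi(0)) because Psi(0) = 0 in
    Om. The gradient of Psi(0) itself may not be zero pointwise, hence the
    detour by the values of Psi. *)
Lemma memory_termE t : 0 <= t <= T ->
  memory_term Om alpha GPsi t = fractional_memory alpha N t.
Proof.
move=> tT; have /andP[t0 t1] := tT.
have e0 : sqnormL2 Om (GPsi t) = N t 0.
  rewrite (sqnormL2E mOm (GPsi_L2 tT)).
  rewrite (vip_potential tT (ilap_dirichlet Psi_sol tT)).
  rewrite /N (vip_potentialB tT T0 (potentialB_H10 tT T0)).
  apply: eq_Rintegral => x /set_mem Ox.
  by rewrite (ilap_init Psi_sol Ox) subr0.
rewrite /memory_term /fractional_memory e0; congr (_ + _ * _).
apply: eq_Rintegral => tau; rewrite inE /= in_itv/= => /andP[h1 h2].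
rewrite /memory_integrand sqnormL2E//.
by apply: in_vL2B => //; apply: GPsi_L2; rewrite ?h1//= (le_trans h2).
Qed.

Lemma Gamma_ge0 (z : R) : 0 <= Gamma z.
Proof.
by apply: Rintegral_ge0 => x _; rewrite mulr_ge0 ?powR_ge0 ?expR_ge0.
Qed.

Theorem energy_dissipation s t : 0 <= s -> s <= t -> t <= T ->
  let E := energy Om eps u Gu in
  let Emod := modified_energy Om alpha gamma eps u Gu GPsi in
  [/\ E t <= Emod t, Emod t <= Emod s & Emod s <= E 0].
Proof.
move=> s0 st tT E Emod.
have [C C0 NC] := potential_dist_le.
have N_ge0 a b : 0 <= N a b := vip_ge0 _ _.
have N_sym a b : N a b = N b a.
  by apply: eq_bigr => i _; apply: eq_Rintegral => x _; rewrite !mxE; ring.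
have N_diag a : N a a = 0.
  rewrite /N /vip big1// => i _.
  rewrite /ip /Rintegral integral0_eq// => x _.
  by rewrite !mxE subrr mulr0.
have k0 : 0 <= (gamma * Gamma (1 - alpha))^-1.
  by rewrite invr_ge0 mulr_ge0 ?Gamma_ge0// ltW.
have [] := @fractional_dissipation R T alpha (gamma * Gamma (1 - alpha))^-1 C E N N2
  alpha01 k0 C0 N_ge0 N_sym N_diag potential_dist_CS NC solution_dist_lip
  solution_dist_cvg integrable_potential_dist
  (fun t s tT sT => (energy_inequality tT sT).1)
  (fun t s tT sT => (energy_inequality tT sT).2)
  T_gt0 energy_lsc s t s0 st tT.
have tT' : 0 <= t <= T by rewrite (le_trans s0 st).
have sT' : 0 <= s <= T by rewrite s0 (le_trans st tT).
have EmodE r : 0 <= r <= T -> Emod r =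
    E r + (gamma * Gamma (1 - alpha))^-1 * fractional_memory alpha N r.
  by move=> rT; rewrite /Emod /modified_energy memory_termE.
by move=> h1 h2 h3; rewrite (EmodE t tT') (EmodE s sT').
Qed.

End dissipation.

Theorem theorem5p1 (R : realType) (n : nat) (Om : set 'rV[R]_n.+1)
    (T alpha gamma eps : R)
    (u Psi : R -> 'rV[R]_n.+1 -> R)
    (Gu GPsi : R -> 'rV[R]_n.+1 -> 'rV[R]_n.+1)
    (Om_open : open Om) (Om_bounded : bounded_set Om)
    (T_gt0 : 0 < T) (alpha01 : 0 < alpha < 1)
    (gamma_gt0 : 0 < gamma) (eps_gt0 : 0 < eps)
    (u_sol : tfCH_solution Om T alpha gamma eps u Gu)
    (Psi_sol : inverse_laplacian Om T u Psi GPsi)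
    (D_def : forall beta, beta = alpha \/ beta = alpha + 1 ->
       forall t, 0 < t <= T -> memory_well_defined Om beta GPsi t) :
  let E := energy Om eps u Gu in
  let Emod := modified_energy Om alpha gamma eps u Gu GPsi in
  forall s t : R, 0 <= s -> s <= t -> t <= T ->
    [/\ E t <= Emod t, Emod t <= Emod s & Emod s <= E 0].
Proof.
move=> E Emod s t s0 st tT.
exact: (energy_dissipation Om_open Om_bounded T_gt0 alpha01 gamma_gt0 u_sol Psi_sol
  (D_def alpha (or_introl erefl)) s0 st tT).
Qed.
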